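(* Let $X(t)$, $t\ge 0$, be the on-off process with on-state $0$ and two off-states $1,2$ constructed in the context, and let $S(t)=\int_0^t 1_{\{X(s)=1\}}\,ds$ and $L(t)=\int_0^t 1_{\{X(s)=2\}}\,ds$ be its occupation times in states $1$ and $2$. Let $u,v>0$ and $u+v<t$. Then \begin{align*} \Pr(S(t)=0,L(t)=0,X(t)=0)&=1-F_U(t),\\ \Pr(S(t)=0,L(t)\in dv,X(t)=0)/dv&=\sum_{n=1}^\infty f_L^{(n)}(v)\left[F_U^{(n)}(t-v)-F_U^{(n+1)}(t-v)\right]p_2^n,\\ \Pr(S(t)\in du, L(t)=0, X(t)=1)/du&=\sum_{n=0}^\infty p_1^{n+1}f_U^{(n+1)}(t-u)\left[F_S^{(n)}(u)-F_S^{(n+1)}(u)\right], \end{align*} and the defective joint densities $p_{SLj}(u,v,t)=\frac{1}{du\,dv}\Pr(S(t)\in du,\,L(t)\in dv,\,X(t)=j)$ for $j=0,1$ are given by \begin{align*} p_{SL0}(u, v, t)&=\sum_{n=1}^\infty\sum_{k=1}^{n-1}\binom{n}{k}p_1^kp_2^{n-k}f_S^{(k)}(u)f_L^{(n-k)}(v)\left[F_U^{(n)}(t-u-v)-F_U^{(n+1)}(t-u-v)\right],\\ p_{SL1}(u, v, t)&=\sum_{n=0}^\infty\sum_{k=0}^{n-1} \binom{n}{k}p_1^{k+1}p_2^{n-k}f_U^{(n+1)}(t-u-v)f_L^{(n-k)}(v)\left[F_S^{(k)}(u)-F_S^{(k+1)}(u)\right]. \end{align*}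
   Context: **Random inputs.** On a probability space there are given four mutually independent sequences of non-negative random variables: $\{U_k\}_{k\ge1}$ i.i.d. with cdf $F_U$ and pdf $f_U$; $\{S_k\}_{k\ge1}$ i.i.d. with cdf $F_S$ and pdf $f_S$; $\{L_k\}_{k\ge1}$ i.i.d. with cdf $F_L$ and pdf $f_L$ (all three distributions are absolutely continuous); and $\{\xi_k\}_{k\ge1}$ i.i.d. with $\Pr(\xi_k=1)=p_1>0$ and $\Pr(\xi_k=0)=p_2=1-p_1$. **The process.** Set $X(0)=0$, $T_0=0$. For $i=1,2,\ldots$: let $T_{2i-1}=T_{2i-2}+U_i$ and $X(t)=0$ for all $t\in[T_{2i-2},T_{2i-1})$; then, if $\xi_i=1$, let $T_{2i}=T_{2i-1}+S_i$ and $X(t)=1$ for all $t\in[T_{2i-1},T_{2i})$; otherwise let $T_{2i}=T_{2i-1}+L_i$ and $X(t)=2$ for all $t\in[T_{2i-1},T_{2i})$. **Defective densities.** Densities are with respect to Lebesgue measure and, as usual, determined up to null sets. $\Pr(S(t)=0,L(t)\in dv,X(t)=0)/dv$ denotes the density in $v\in(0,t)$ of the measure $B\mapsto\Pr(S(t)=0,L(t)\in B,X(t)=0)$ on Borel sets $B\subset(0,t)$; $\Pr(S(t)\in du,L(t)=0,X(t)=1)/du$ denotes the density in $u\in(0,t)$ of the measure $B\mapsto\Pr(S(t)\in B,L(t)=0,X(t)=1)$ on Borel sets $B\subset(0,t)$; and $p_{SLj}(\cdot,\cdot,t)$ is the two-dimensional density of the measure $B\mapsto\Pr((S(t),L(t))\in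 B,\,X(t)=j)$ on Borel sets $B\subset\{(u,v):u,v>0,\ u+v<t\}$. **Convolution notation.** For a cdf $G$ with pdf $g$, $G^{(n)}$ and $g^{(n)}$ are the $n$-fold convolutions of $G$ and of $g$, i.e. the cdf and pdf of the sum of $n$ independent random variables with cdf $G$ (so $G^{(1)}=G$, $g^{(1)}=g$). $G^{(0)}$ is the cdf of the random variable equal to $0$ with probability $1$. Any summation over the empty set is $0$. *)

(* Defs.v *)
From HB Require Import structures.
From mathcomp Require Import all_boot all_order all_algebra finmap.
From mathcomp Require Import all_classical all_reals all_analysis.
From mathcomp Require Import measurable_realfun.

Set Implicit Arguments.
Unset Strict Implicit.
Unset Printing Implicit Defensive.

Import Order.TTheory GRing.Theory Num.Theory.
Import numFieldNormedType.Exports.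

Local Open Scope classical_set_scope.
Local Open Scope ring_scope.

Section independence.
Context d (T : measurableType d) (R : realType) (P : probability T R).

Definition mutually_independent (I : choiceType) (E : I -> set (set T)) :=
  forall (J : {fset I}) (A : I -> set T),
    (forall i, i \in J -> E i (A i)) ->
    P (\bigcap_(i in [set` J]) A i) = (\prod_(i <- J) P (A i))%E.

Definition sigma_rv (X : {RV P >-> R}) : set (set T) :=
  g_sigma_algebra_preimage X.

Definition sigma_seq (X : nat -> {RV P >-> R}) : set (set T) :=
  <<s \bigcup_k sigma_rv (X k) >>.

Definition independent_rvs (X : nat -> {RV P >-> R}) :=
  mutually_independent (fun k => sigma_rv (X k)).

Definition independent_seqs4 (X0 X1 X2 X3 : nat -> {RV P >-> R}) :=
  mutually_independent
    (fun i : 'I_4 => sigma_seq (nth X0 [:: X0; X1; X2; X3] i)).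

End independence.

(* Only the Borel sets contained in D are tested, so m may be defective and f
   is determined only up to null sets of D. *)
Definition is_density d (E : measurableType d) (R : realType)
    (mu : {measure set E -> \bar R}) (D : set E)
    (m : set E -> \bar R) (f : E -> \bar R) : Prop :=
  [/\ measurable_fun D f,
      (forall x, D x -> (0 <= f x)%E) &
      forall B, measurable B -> B `<=` D ->
        m B = (\int[mu]_(x in B) f x)%E].

Definition has_cdf_pdf d (T : measurableType d) (R : realType)
    (P : probability T R) (X : {RV P >-> R}) (F f : R -> R) : Prop :=
  [/\ (forall x, cdf X x = (F x)%:E), (forall x, 0 <= f x) &
      is_density (@lebesgue_measure R) setT (distribution P X) (EFin \o f)].

Section convolution.
Context (R : realType).

Fixpoint cdf_conv (G : cumulative R R) (n : nat) (x : R) : \bar R :=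
  if n is m.+1 then
    (\int[lebesgue_stieltjes_measure G]_y cdf_conv G m (x - y))%E
  else (\1_[set y : R | 0 <= y] x)%:E.

(* Extended-real valued: the integral may be +oo on a null set. The 0-fold
   convolution of a pdf is a Dirac mass, not a density; the value at n = 0 is
   a dummy. *)
Fixpoint pdf_conv (g : R -> R) (n : nat) (x : R) : \bar R :=
  match n with
  | 0 => 0%E
  | 1 => (g x)%:E
  | m.+1 => (\int[@lebesgue_measure R]_y (pdf_conv g m (x - y)
                                          * (g y)%:E))%E
  end.

End convolution.

(* All input sequences are indexed from 0: U k, S k, L k, xi k are the usual
   U_(k+1), S_(k+1), L_(k+1), xi_(k+1). *)
Section process.
Context d (T : measurableType d) (R : realType) (U S L xi : nat -> T -> R).

Definition off_time (i : nat) (w : T) : R :=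
  if xi i w == 1 then S i w else L i w.

(* T_(2i) and T_(2i+1) *)
Fixpoint even_epoch (i : nat) (w : T) : R :=
  if i is j.+1 then even_epoch j w + U j w + off_time j w else 0.

Definition odd_epoch (i : nat) (w : T) : R := even_epoch i w + U i w.

(* For non-negative inputs the three cases are mutually exclusive. The value 3
   is a dummy: it is taken only at times t not covered by any cycle, i.e. for
   t < 0 or t >= sup_n T_n. *)
Definition onoff (w : T) (t : R) : nat :=
  if `[< exists i, even_epoch i w <= t < odd_epoch i w >] then 0
  else if `[< exists2 i, xi i w = 1
                & odd_epoch i w <= t < even_epoch i.+1 w >] then 1
  else if `[< exists2 i, xi i w <> 1
                & odd_epoch i w <= t < even_epoch i.+1 w >] then 2
  else 3.

Definition occupation (j : nat) (t : R) (w : T) : R :=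
  \int[@lebesgue_measure R]_(s in `[0, t]) \1_[set s | onoff w s = j] s.

End process.

(* Main.v *)
(** On the event that the on-off process is, at time [t], in its [n]-th on
    period (resp. off period), the two occupation times are explicit: split the
    first [n] cycles according to the set [e] of indices with [xi = 1]; then
    [S(t)] is the sum of the [S_i] over [e] and [L(t)] the sum of the [L_i] over
    the complement of [e], except that in state 1 the pair is
    [(t - U_1 - .. - U_(n+1) - L(t), L(t))].  The event itself says that the
    partial sums of [U] (resp. of the [S_i] over [e]) straddle the time left,
    which has probability [F^(n) - F^(n+1)] there.  By independence the
    contribution of [e] is [p1^k p2^(n-k)], [k = #|e|], times an integral against
    a product of laws of partial sums, which depends on [k] only; summing over
    [e] gives the binomial coefficient, and summing over [n] gives the measures
    of the theorem.  Sums over nonempty index sets have the density [pdf_conv],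
    empty sums are atoms at [0], which accounts for the ranges of [k]. *)

From HB Require Import structures.
Require Import Defs.
From mathcomp Require Import all_boot all_order all_algebra finmap.
From mathcomp Require Import all_classical all_reals all_analysis.
From mathcomp Require Import measurable_realfun ring lra.

Set Implicit Arguments.
Unset Strict Implicit.
Unset Printing Implicit Defensive.

Import Order.TTheory GRing.Theory Num.Theory.
Import numFieldNormedType.Exports.

Local Open Scope classical_set_scope.
Local Open Scope ring_scope.

(** All five formulas come from two identities, one for each state, valid for every Borel set [C] of
    the plane: the law of the pair of occupation times on [X t = j] is a double series of integrals
    over [C] against product laws of partial sums. The atoms are kept in these identities, the empty
    sum being a Dirac mass at 0, and they are sorted out only when [C] is specialised to a subset of
    the open triangle, to [{0} x B], [B x {0}] or [{(0,0)}]. Each time a rectangle with a null side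
    decides which [k] survive. Fixing the pattern [e] makes all index sets deterministic, so that
    only sums over fixed lists occur. Independence is a property of sigma-algebras, hence events
    must be shown measurable for the sigma-algebra generated by the sequences concerned and not
    merely for the ambient one. In state 1 the natural coordinates are the sums of [U] and of [L];
    the map [(x, y) -> (t - x - y, y)], an involution preserving Lebesgue measure, leads back to the
    occupation times. *)

(** * Integration against a measure with a density *)

Section density.
Local Open Scope ereal_scope.
Context d (E : measurableType d) (R : realType).
Variables (mu nu : {measure set E -> \bar R}) (f : E -> \bar R).
Hypotheses (mf : measurable_fun setT f) (f0 : forall x, 0 <= f x)
  (nuE : forall A, measurable A -> nu A = \int[mu]_(x in A) f x).

Import HBNNSimple.

Let integral_density_nnsfun (h : {nnsfun E >-> R}) :
  \int[nu]_x (h x)%:E = \int[mu]_x ((h x)%:E * f x).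
Proof.
under [LHS]eq_integral do rewrite fimfunE -fsumEFin//.
rewrite [LHS]ge0_integral_fsum//; last 2 first.
  - by move=> r; exact/measurable_EFinP/measurableT_comp.
  - by move=> n x _; rewrite EFinM nnfun_muleindic_ge0.
under [RHS]eq_integral.
  move=> x xD; rewrite fimfunE -fsumEFin// muleC ge0_mule_fsumr; last first.
    by move=> r; rewrite EFinM nnfun_muleindic_ge0.
  over.
rewrite [RHS]ge0_integral_fsum//; last 2 first.
  - move=> r; apply: emeasurable_funM => //.
    by apply/measurable_EFinP; do 2 apply/measurableT_comp => //.
  - by move=> n x _; rewrite mule_ge0// EFinM nnfun_muleindic_ge0.
apply: eq_fsbigr => r _; rewrite integralZl_indic_nnsfun//= integral_indic//.
rewrite setIT nuE//.
have [r0|r0] := ltP r 0%R.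
  rewrite preimage_nnfun0// integral_set0 mule0 integral0_eq// => x _.
  by rewrite indicE in_set0 mulr0 mule0.
rewrite integral_mkcond epatch_indic -ge0_integralZl//.
- by apply: eq_integral => x _; rewrite EFinM [RHS]muleCA.
- by apply: emeasurable_funM => //; exact/measurable_EFinP.
- by move=> x _; rewrite mule_ge0// lee_fin.
Qed.

(** The density takes extended values because a convolution of pdfs may be infinite on a null set.
    Simple functions come first, then monotone convergence. *)
Lemma ge0_integral_density (h : E -> \bar R) : measurable_fun setT h ->
  (forall x, 0 <= h x) -> \int[nu]_x h x = \int[mu]_x (h x * f x).
Proof.
move=> mh h0.
pose h_ := nnsfun_approx measurableT mh.
have cvg_h x : (h_ n x)%:E @[n --> \oo] --> h x.
  exact: cvg_nnsfun_approx.
transitivity (lim (\int[nu]_x (h_ n x)%:E @[n --> \oo])).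
  rewrite -monotone_convergence//=.
  - by apply: eq_integral => ? /[!inE] xD; apply/esym/cvg_lim => //=.
  - by move=> n; exact/measurable_EFinP/measurable_funTS.
  - by move=> n ? _; rewrite lee_fin.
  - by move=> ? _ ? ? mn; rewrite lee_fin; exact/lefP/nd_nnsfun_approx.
under eq_fun do rewrite integral_density_nnsfun.
rewrite -monotone_convergence//=.
- apply: eq_integral => x _; apply/cvg_lim => //.
  case fx : (f x) (f0 x) => [r| |]//= _; first exact: cvgeZr.
  (* Here [f x = +oo], and multiplication by it is not continuous at 0. If [h x = 0], the increasing
     approximations are all 0 and the products are constant; otherwise the limit product is
     defined. *)
  have [hx0|hx0] := eqVneq (h x) 0.
    have h_0 n : (h_ n x)%:E = 0.
      have nd : nondecreasing_seq (fun k => (h_ k x)%:E).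
        by move=> i j ij; rewrite lee_fin; exact/lefP/nd_nnsfun_approx.
      have hn0 : 0 <= (h_ n x)%:E by rewrite lee_fin.
      apply/le_anti; rewrite hn0 andbT -hx0 -(cvg_lim _ (cvg_h x))//.
      rewrite (cvg_lim _ (ereal_nondecreasing_cvgn nd))//.
      by apply: ereal_sup_ubound; exists n.
    by under eq_fun do rewrite h_0 mul0e; rewrite hx0 mul0e; exact: cvg_cst.
  apply: cvgeM; [|exact: cvg_h|exact: cvg_cst].
  by rewrite mule_defE (negbTE hx0).
- by move=> n; apply: emeasurable_funM => //; exact/measurable_EFinP.
- by move=> n x _; rewrite mule_ge0// lee_fin.
- move=> x _ m n mn; rewrite lee_wpmul2r// lee_fin.
  exact/lefP/nd_nnsfun_approx.
Qed.

End density.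

Section product_measure.
Context d1 d2 (T1 : measurableType d1) (T2 : measurableType d2) (R : realType).
Variables (m1 m1' : {sigma_finite_measure set T1 -> \bar R}).
Variables (m2 m2' : {sigma_finite_measure set T2 -> \bar R}).

(** Serves to replace the laws of sums over arbitrary index sets by those over initial segments. *)
Lemma eq_product_measure :
  (forall A, measurable A -> m1 A = m1' A) ->
  (forall A, measurable A -> m2 A = m2' A) ->
  forall D, measurable D -> (m1 \x m2)%E D = (m1' \x m2')%E D.
Proof.
move=> m11' m22'; apply: product_measure_unique => A B mA mB.
etransitivity; first exact: product_measure1E.
by rewrite m11'// m22'.
Qed.

End product_measure.

(** * Independence of generated sigma-algebras, joint laws *)

Section independence.
Context d (T : measurableType d) (R : realType) (P : probability T R).
Local Open Scope ereal_scope.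

(** For fixed [B] both sides are finite measures in [A]: the restriction of [P] to [B], and [P]
    scaled by [P B]. They agree on a pi-system that contains the whole space. *)
Lemma indep_g_sigma_algebra (G : set (set T)) (B : set T) :
  setI_closed G -> G setT -> G `<=` measurable -> measurable B ->
  (forall A, G A -> P (A `&` B) = P A * P B) ->
  forall A, <<s G >> A -> P (A `&` B) = P A * P B.
Proof.
move=> GI GT mG mB GB A GA.
have pB : (0 <= fine (P B))%R by rewrite fine_ge0.
have -> : P A * P B = mscale (NngNum pB) P A.
  by rewrite /mscale/= fineK ?fin_num_measure// muleC.
rewrite -/(mrestr P mB A).
apply: (g_sigma_algebra_measure_unique G mG (fun=> setT)) => //.
- by rewrite -subTset => x _; exists 0%N.
- by move=> C GC; rewrite /= /mrestr GB// /mscale/= fineK ?fin_num_measure// muleC.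
- by move=> k; rewrite -ge0_fin_numE// fin_num_measure.
Qed.

Section groups.
Context (I : choiceType) (E : I -> set (set T)).
Hypotheses (indepE : mutually_independent P E) (ET : forall i, E i setT)
  (EI : forall i, setI_closed (E i)) (mE : forall i, E i `<=` measurable).

(** The pi-system of finite intersections. The family [B] is total, with value [setT] outside [J],
    so that two cylinders can be brought to a common finite index set and intersected index by
    index. *)
Let cyl (J : set I) : set (set T) := [set A | exists (K : {fset I}) B,
  [/\ forall i, E i (B i), forall i, ~ J i -> B i = setT
    & A = \bigcap_(i in [set` K]) B i]].

Let cyl_widen (K L : {fset I}) (B : I -> set T) : (forall i, i \in K -> i \in L) ->
  \bigcap_(i in [set` K]) B i =
  \bigcap_(i in [set` L]) (if i \in K then B i else setT).
Proof.
move=> KL; apply/seteqP; split=> x Bx i /= iK.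
  by case: ifPn => // /Bx.
by have := Bx i (KL _ iK); rewrite iK.
Qed.

Let cyl_setI J : setI_closed (cyl J).
Proof.
move=> _ _ [K [B [EB BT ->]]] [K' [B' [EB' BT' ->]]].
exists (K `|` K')%fset.
exists (fun i => (if i \in K then B i else setT)
   `&` (if i \in K' then B' i else setT)); split.
- by move=> i; apply: EI; case: ifP.
- by move=> i Ji; rewrite BT// BT'// !if_same setIT.
- rewrite bigcapI -!cyl_widen// => i; rewrite in_fsetU => ->//.
  by rewrite orbT.
Qed.

Let cylT J : cyl J setT.
Proof.
exists fset0, (fun=> setT); split => //.
by apply/esym; rewrite bigcapT.
Qed.

Let m_cyl J : cyl J `<=` measurable.
Proof.
move=> _ [K [B [EB BT ->]]]; apply: fin_bigcap_measurable => // i _.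
exact/mE/EB.
Qed.

Let sub_cyl (J : set I) : \bigcup_(i in J) E i `<=` cyl J.
Proof.
move=> A [i Ji EA]; exists [fset i]%fset, (fun k => if k == i then A else setT).
split.
- by move=> k; case: eqP => [->|].
- by move=> k Jk; case: eqP => // ki; rewrite ki in Jk.
- apply/seteqP; split=> [x Ax k /=|x /(_ i)].
    by case: ifP.
  by rewrite /= eqxx; apply; rewrite inE.
Qed.

(** The product formula holds for two cylinders; the pi-system argument then extends it in one
    argument and afterwards in the other. *)
Lemma mutually_independent_groups (J K : set I) (A B : set T) :
  [disjoint J & K]%classic ->
  <<s \bigcup_(i in J) E i >> A -> <<s \bigcup_(i in K) E i >> B ->
  P (A `&` B) = P A * P B.
Proof.
move=> /disj_set2P JK gA gB.
have msub (L : set I) : <<s \bigcup_(i in L) E i >> `<=` @measurable _ T.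
  apply: smallest_sub; first exact: sigma_algebra_measurable.
  by move=> C [i _]; exact: mE.
have cylcyl A' B' : cyl J A' -> cyl K B' -> P (A' `&` B') = P A' * P B'.
  move=> [KA [BA [EA AT ->]]] [KB [BB [EB BT ->]]].
  pose L := (KA `|` KB)%fset.
  have KAL i : i \in KA -> i \in L by rewrite in_fsetU => ->.
  have KBL i : i \in KB -> i \in L by rewrite in_fsetU => ->; rewrite orbT.
  rewrite (cyl_widen BA KAL) (cyl_widen BB KBL) -bigcapI.
  have E1 i : E i (if i \in KA then BA i else setT) by case: ifP.
  have E2 i : E i (if i \in KB then BB i else setT) by case: ifP.
  rewrite !indepE//; last by move=> i _; exact: EI.
  rewrite -big_split/=; apply: eq_bigr => i _.
  (* No index lies in both [J] and [K], so at each index one of the two sets is [setT]. *)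
  have [iJ|iJ] := pselect (J i).
    rewrite BT ?if_same ?setIT ?probability_setT ?mule1// => iK.
    by have : set0 i by rewrite -JK.
  by rewrite (AT _ iJ) if_same setTI probability_setT mul1e.
have cylB A' : cyl J A' -> P (A' `&` B) = P A' * P B.
  move=> cA'; rewrite setIC muleC.
  apply: (indep_g_sigma_algebra (@cyl_setI K)) => //.
  - exact: m_cyl cA'.
  - by move=> B' cB'; rewrite setIC muleC cylcyl.
  - exact: sub_sigma_algebra2 (@sub_cyl K) _ gB.
apply: (indep_g_sigma_algebra (@cyl_setI J)) => //.
- exact: msub gB.
- exact: sub_sigma_algebra2 (@sub_cyl J) _ gA.
Qed.

End groups.

Definition indep_rv d1 d2 (T1 : measurableType d1) (T2 : measurableType d2)
    (X : T -> T1) (Y : T -> T2) :=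
  forall A B, measurable A -> measurable B ->
    P (X @^-1` A `&` Y @^-1` B) = P (X @^-1` A) * P (Y @^-1` B).

Lemma indep_rv_joint d1 d2 (T1 : measurableType d1) (T2 : measurableType d2)
    (X : {mfun T >-> T1}) (Y : {mfun T >-> T2}) (D : set (T1 * T2)) :
  indep_rv X Y -> measurable D ->
  P [set w | D (X w, Y w)] = (distribution P X \x distribution P Y) D.
Proof.
move=> XY mD.
have mXY : measurable_fun setT (fun w => (X w, Y w)).
  exact/measurable_fun_pair.
pose XYm : {mfun T >-> (T1 * T2)%type} :=
  HB.pack (fun w => (X w, Y w)) (isMeasurableFun.Build _ _ _ _ _ mXY).
rewrite (@product_measure_unique _ _ _ _ _ (distribution P X)
  (distribution P Y) (distribution P XYm))//.
Qed.

End independence.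

(** * Reflections and translations of the line *)

Section lebesgue_invariance.
Context {R : realType}.
Local Open Scope ereal_scope.
Local Notation mu := (@lebesgue_measure R).

Lemma ge0_integral_reflection (c : R) (h : R -> \bar R) :
  measurable_fun setT h -> (forall x, 0 <= h x) ->
  \int[mu]_x h (c - x)%R = \int[mu]_x h x.
Proof.
move=> mh h0.
pose cB : measurableTypeR R -> measurableTypeR R := fun x => (c - x)%R.
have mc : measurable_fun setT cB by exact: measurable_funB.
pose cm : {mfun measurableTypeR R >-> measurableTypeR R} :=
  HB.pack cB (isMeasurableFun.Build _ _ _ _ _ mc).
transitivity (\int[pushforward mu cm]_x h x).
  by rewrite ge0_integral_pushforward.
apply: eq_measure_integral => A mA _; apply/esym.
apply: (lebesgue_measure_unique (mu := pushforward mu cm)) => // _ [[a b]] _ <-.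
(* The reflection moves the closed end to the other side, which does not change the length. *)
have cmE : cB @^-1` `]a, b] = `[(c - b)%R, (c - a)%R[%classic.
  apply/seteqP; split=> x /=; rewrite !in_itv/= => /andP[ax xb]; apply/andP.
    by split; [rewrite lerBlDr -lerBlDl|rewrite ltrBrDr -ltrBrDl].
  by split; [rewrite ltrBrDr -ltrBrDl|rewrite lerBlDr -lerBlDl].
transitivity (mu `[(c - b)%R, (c - a)%R[); last by rewrite -cmE.
rewrite !lebesgue_measure_itv/= !lte_fin ltrD2l ltrN2; case: ifPn => // _.
by rewrite -!EFinB; congr EFin; ring.
Qed.

Lemma ge0_integral_translation (c : R) (h : R -> \bar R) :
  measurable_fun setT h -> (forall x, 0 <= h x) ->
  \int[mu]_x h (x + c)%R = \int[mu]_x h x.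
Proof.
move=> mh h0; rewrite -(ge0_integral_reflection c mh h0).
(* A translation is the composite of two reflections: [c - (0 - x) = x + c]. *)
rewrite -[RHS](ge0_integral_reflection 0%R (h := fun x => h (c - x)%R)).
- by apply: eq_integral => x _; rewrite sub0r opprK addrC.
- by apply: measurableT_comp => //; exact: measurable_funB.
- by [].
Qed.

End lebesgue_invariance.

(** * Convolution powers and the laws of partial sums *)

Section pdf_conv.
Context {R : realType} (g : R -> R).
Hypotheses (mg : measurable_fun setT g) (g0 : forall x, 0 <= g x).
Local Open Scope ereal_scope.

Lemma pdf_convSS n x : pdf_conv g n.+2 x =
  \int[@lebesgue_measure R]_y (pdf_conv g n.+1 (x - y) * (g y)%:E).
Proof. by []. Qed.

Lemma pdf_conv_ge0 n x : 0 <= pdf_conv g n x.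
Proof.
elim: n x => [//|[_ x|n IH x]]; first by rewrite lee_fin.
by rewrite pdf_convSS integral_ge0// => y _; rewrite mule_ge0// lee_fin.
Qed.

Lemma measurable_pdf_conv n : measurable_fun setT (pdf_conv g n).
Proof.
elim: n => [|[_|n IH]]; [exact: measurable_cst|exact/measurable_EFinP|].
pose h (z : R * R) := pdf_conv g n.+1 (z.1 - z.2) * (g z.2)%:E.
apply: (measurable_fun_fubini_tonelli_F (m2 := @lebesgue_measure R) h); last first.
  by move=> z; rewrite mule_ge0 ?pdf_conv_ge0// lee_fin.
apply: emeasurable_funM.
  apply: (measurableT_comp IH); apply: measurable_funB.
    exact: measurable_fst.
  exact: measurable_snd.
apply/measurable_EFinP; apply: (measurableT_comp mg).
exact: measurable_snd.
Qed.

End pdf_conv.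

Section partial_sums.
Context d (T : measurableType d) (R : realType) (P : probability T R).
Variable X : nat -> {RV P >-> R}.
Local Notation mR := (measurableTypeR R).
Local Open Scope ereal_scope.

(* [R] and [measurableTypeR R] have the same measurable sets but different
   displays: measures built from [lebesgue_measure] live on the latter only. *)
Definition toR (Y : {RV P >-> R}) : T -> measurableTypeR R := Y.

Lemma measurable_toR Y : measurable_fun setT (toR Y).
Proof. exact: (measurable_funPT Y). Qed.

HB.instance Definition _ Y :=
  isMeasurableFun.Build _ _ _ _ (toR Y) (measurable_toR Y).

Definition psum (s : seq nat) (w : T) : measurableTypeR R :=
  (\sum_(j <- s) X j w)%R.

Lemma measurable_psum s : measurable_fun setT (psum s).
Proof.
suff : measurable_fun setT (psum s : T -> R) by [].
exact: measurable_sum.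
Qed.

HB.instance Definition _ s :=
  isMeasurableFun.Build _ _ _ _ (psum s) (measurable_psum s).

Lemma sigma_psum (J : set nat) s (B : set R) : {in s, forall j, J j} ->
  measurable B ->
  <<s \bigcup_(j in J) sigma_rv (X j) >> (psum s @^-1` B).
Proof.
move=> sJ mB; rewrite -(setTI (psum s @^-1` B)).
pose T' := g_sigma_algebraType (\bigcup_(j in J) sigma_rv (X j)).
suff: measurable_fun setT (psum s : T' -> R) by apply.
(* [measurable_sum] asks for measurability of the summand at every [j]; the guard makes it 0 at
   indices off [s], where [X j] need not be measurable for [T']. *)
have -> : psum s = fun w => (\sum_(j <- s) (if j \in s then X j w else 0))%R.
  by apply/funext => w; apply: eq_big_seq => j ->.
apply: measurable_sum => j.
case: (boolP (j \in s)) => [/sJ Jj|_]; last exact: measurable_cst.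
move=> _ C mC; apply: sub_sigma_algebra; exists j => //.
by exists C.
Qed.

Lemma sigma_rv_setT k : sigma_rv (X k) setT.
Proof. by exists setT => //; rewrite preimage_setT setTI. Qed.

Lemma sigma_rv_setI k : setI_closed (sigma_rv (X k)).
Proof.
move=> _ _ [A mA <-] [B mB <-]; exists (A `&` B); first exact: measurableI.
by rewrite !setTI preimage_setI.
Qed.

Lemma sigma_rv_measurable k : sigma_rv (X k) `<=` measurable.
Proof. by move=> _ [A mA <-]; exact: measurable_funPT. Qed.

Lemma psum_nil_null : distribution P (psum [::]) (~` [set 0%R]) = 0.
Proof.
rewrite -(measure0 P); congr (P _); apply/seteqP; split => // w /=.
by rewrite /psum big_nil => /(_ erefl).
Qed.

Lemma integral_psum_nil (h : mR -> \bar R) : measurable_fun setT h ->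
  (forall x, 0 <= h x) -> \int[distribution P (psum [::])]_x h x = h 0%R.
Proof.
move=> mh h0; rewrite ge0_integral_distribution//.
rewrite (eq_integral (fun=> h 0%R)); last first.
  by move=> w _; rewrite /= /psum big_nil.
by rewrite integral_cst// -[X in _ * X]/(P setT) probability_setT mule1.
Qed.

Hypothesis indepX : independent_rvs X.

Lemma indep_psum m s : m \notin s -> indep_rv P (toR (X m)) (psum s).
Proof.
move=> ms A B mA mB.
apply: (mutually_independent_groups indepX sigma_rv_setT sigma_rv_setI
  sigma_rv_measurable (J := [set m]) (K := [set` s])).
- by apply/disj_set2P; rewrite -subset0 => j [->] /=; rewrite (negbTE ms).
- by apply: sub_sigma_algebra; exists m => //; exists A => //; rewrite setTI.
- exact: sigma_psum.
Qed.

Lemma psum_cons m s w : psum (m :: s) w = (X m w + psum s w)%R.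
Proof. by rewrite /psum big_cons. Qed.

(** Convolution of laws, common source of the recursions of [cdf_conv] and [pdf_conv]. *)
Lemma psum_cons_distribution m s A : m \notin s -> measurable A ->
  distribution P (psum (m :: s)) A =
  \int[distribution P (toR (X m))]_y distribution P (psum s) [set x | A (y + x)%R].
Proof.
move=> ms mA.
have mD : measurable [set z : R * R | A (z.1 + z.2)%R].
  have mh : measurable_fun setT (fun z : R * R => (z.1 + z.2)%R).
    exact: measurable_funD.
  by rewrite -[X in measurable X]setTI; exact: mh.
transitivity (P [set w | [set z : R * R | A (z.1 + z.2)%R] (toR (X m) w, psum s w)]).
  rewrite /distribution /pushforward; congr (P _); apply/seteqP.
  by split=> w /=; rewrite psum_cons.
rewrite indep_rv_joint//; last exact: indep_psum.
rewrite /product_measure1; apply: eq_integral => y _ /=; congr (P _).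
by apply/seteqP; split => w /=; rewrite /xsection/= inE.
Qed.

Variables (F : cumulativeBounded (0 : R) (1 : R)) (f : R -> R).
Hypothesis lawX : forall k, has_cdf_pdf (X k) F f.

Lemma psum_cdf s x : uniq s ->
  P [set w | (psum s w <= x)%R] = cdf_conv F (size s) x.
Proof.
(* [cdf_conv] integrates against the Stieltjes measure of [F]. This is the law of [X k], since both
   give []a, b]] the mass [F b - F a]. *)
have lsF k A : measurable A ->
    lebesgue_stieltjes_measure F A = distribution P (toR (X k)) A.
  have [cdfX _ _] := lawX k.
  move=> mA.
  apply: (lebesgue_stieltjes_measure_unique (mu := distribution P (toR (X k)))) => //.
  move=> I [[a b]]/= _ <-.
  rewrite /lebesgue_stieltjes_measure /measure_extension/=.
  rewrite measurable_mu_extE/=; last exact: is_ocitv.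
  have [ab | ba] := leP a b; last first.
    by rewrite set_itv_ge ?wlength0 ?measure0// bnd_simp -leNgt ltW.
  rewrite wlength_itv_bnd// EFinB -!cdfX /cdf.
  have : `]a, b]%classic = `]-oo, b] `\` `]-oo, a] => [|->].
    by rewrite -[RHS]setCK setCD setCitvl setUC -[LHS]setCK setCitv.
  rewrite measureD ?setIidr//; first exact: subset_itvl.
  by rewrite -ge0_fin_numE// fin_num_measure.
elim: s x => [|m s IH] x /=.
  move=> _; rewrite indicE; have [x0|x0] := leP 0%R x.
    rewrite mem_set//= -(@probability_setT _ _ _ P); congr (P _).
    by apply/seteqP; split => w //= _; rewrite /psum big_nil.
  rewrite memNset/=; last by rewrite leNgt x0.
  rewrite -[RHS](measure0 P); congr (P _); rewrite -subset0 => w /=.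
  by rewrite /psum big_nil leNgt x0.
move=> /andP[ms us].
have mx : measurable [set y : R | (y <= x)%R].
  have -> : [set y : R | (y <= x)%R] = `]-oo, x]%classic.
    by apply/seteqP; split => y /=; rewrite in_itv.
  exact: measurable_itv.
rewrite [LHS](psum_cons_distribution ms mx).
rewrite [LHS](eq_measure_integral (lebesgue_stieltjes_measure F)); last first.
  by move=> A mA _; exact/esym/lsF.
apply: eq_integral => y _; rewrite -IH//; congr (P _).
by apply/seteqP; split=> w /=; rewrite -lerBrDl.
Qed.

Lemma law_pdf_conv_ge0 n x : 0 <= pdf_conv f n x.
Proof. by apply: pdf_conv_ge0 => y; have [_ + _] := lawX 0; exact. Qed.

Lemma measurable_law_pdf_conv n : measurable_fun setT (pdf_conv f n).
Proof.
apply: measurable_pdf_conv => [|y]; have [_ f0 [mf _ _]] := lawX 0 => //.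
exact/measurable_EFinP.
Qed.

Lemma psum_pdf s A : uniq s -> (0 < size s)%N -> measurable A ->
  distribution P (psum s) A =
  \int[@lebesgue_measure R]_(x in A) pdf_conv f (size s) x.
Proof.
have f0 x : (0 <= f x)%R by have [_ + _] := lawX 0; exact.
have mf : measurable_fun setT f.
  by have [_ _ [+ _ _]] := lawX 0; move/measurable_EFinP.
have densX k B : measurable B -> distribution P (toR (X k)) B =
    \int[@lebesgue_measure R]_(x in B) (f x)%:E.
  by have [_ _ [_ _]] := lawX k; move=> + mB; exact.
elim: s A => [//|m [_ A _ _ mA|m' s IH A /andP[ms us] _ mA]].
  rewrite -(densX m)//; congr (P _); apply/seteqP.
  by split=> w /=; rewrite /psum big_seq1.
rewrite psum_cons_distribution//.
pose p := pdf_conv f (size (m' :: s)).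
have mp : measurable_fun setT p by exact: measurable_pdf_conv.
have p0 x : 0 <= p x by exact: pdf_conv_ge0.
(* [z.1] is the total and [z.2] the summand at the head of the list. Integrating [z.1] first gives
   the convolution of laws, integrating [z.2] first gives [pdf_conv] on [A]; Tonelli equates the
   two. *)
pose h (z : R * R) := p (z.1 - z.2)%R * (f z.2)%:E * (\1_A z.1)%:E.
have mh : measurable_fun setT h.
  apply: emeasurable_funM; first apply: emeasurable_funM.
  - apply: (measurableT_comp mp); apply: measurable_funB.
      exact: measurable_fst.
    exact: measurable_snd.
  - apply/measurable_EFinP; apply: (measurableT_comp mf).
    exact: measurable_snd.
  - apply/measurable_EFinP; apply: measurableT_comp => //.
have h0 z : 0 <= h z by rewrite !mule_ge0// lee_fin.
(* Translating by [y] passes from the tail sum to the total. *)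
have dE y : distribution P (psum (m' :: s)) [set x | A (y + x)%R] =
    \int[@lebesgue_measure R]_x (p (x - y)%R * (\1_A x)%:E).
  rewrite IH//; last first.
    rewrite -[X in measurable X]setTI.
    have : measurable_fun setT (fun x : R => y + x)%R by exact: measurable_funD.
    exact.
  rewrite integral_mkcond epatch_indic.
  rewrite -[RHS](ge0_integral_translation y); last 2 first.
  - apply: emeasurable_funM.
      by apply: (measurableT_comp mp); exact: measurable_funB.
    exact/measurable_EFinP.
  - by move=> x; rewrite mule_ge0// lee_fin.
  by apply: eq_integral => x _; rewrite addrK (addrC x).
rewrite (ge0_integral_density (f := EFin \o f) (mu := lebesgue_measure)) //=.
- transitivity (\int[lebesgue_measure]_y \int[lebesgue_measure]_x h (x, y)).
    apply: eq_integral => y _; rewrite dE -ge0_integralZr//.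
    + by apply: eq_integral => x _; rewrite /h/= muleAC.
    + apply: emeasurable_funM.
        by apply: (measurableT_comp mp); exact: measurable_funB.
      exact/measurable_EFinP.
    + by move=> x _; rewrite mule_ge0// lee_fin.
    + by rewrite lee_fin.
  transitivity (\int[lebesgue_measure]_x \int[lebesgue_measure]_y h (x, y)).
    exact/esym/(fubini_tonelli (m1 := @lebesgue_measure R)
      (m2 := @lebesgue_measure R) h).
  rewrite [RHS]integral_mkcond epatch_indic.
  apply: eq_integral => x _; rewrite /h/= ge0_integralZr ?lee_fin//.
  + apply: emeasurable_funM; last exact/measurable_EFinP.
    by apply: (measurableT_comp mp); exact: measurable_funB.
  + by move=> y _; rewrite mule_ge0// lee_fin.
- exact/measurable_EFinP.
- exact: densX.
- under eq_fun do rewrite dE.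
  pose k (z : R * R) := p (z.2 - z.1)%R * (\1_A z.2)%:E.
  apply: (measurable_fun_fubini_tonelli_F (m2 := @lebesgue_measure R) k).
    apply: emeasurable_funM.
      apply: (measurableT_comp mp); apply: measurable_funB.
        exact: measurable_snd.
      exact: measurable_fst.
    by apply/measurable_EFinP; apply: measurableT_comp.
  by move=> z; rewrite mule_ge0// lee_fin.
Qed.

Lemma psum_set0_null s : uniq s -> (0 < size s)%N ->
  distribution P (psum s) [set 0%R] = 0.
Proof. by move=> us s0; rewrite psum_pdf// integral_set1. Qed.

(** Nonempty sums of equal length have the same density; two empty sums are the same variable. *)
Lemma psum_distribution s s' A : uniq s -> uniq s' -> size s = size s' ->
  measurable A -> distribution P (psum s) A = distribution P (psum s') A.
Proof.
move=> us us' ss' mA; have [s0|s0] := posnP (size s).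
  by rewrite (size0nil s0) (size0nil (esym (etrans (esym s0) ss'))).
by rewrite !psum_pdf// -?ss'.
Qed.

(** Because [X m] is nonnegative, the event that the longer sum is at most [c] lies inside the same
    event for the shorter one, and the straddling event is their difference. *)
Lemma psum_straddle m s c : uniq (m :: s) -> (forall w, 0 <= X m w)%R ->
  P [set w | (psum s w <= c < psum s w + X m w)%R] =
  cdf_conv F (size s) c - cdf_conv F (size s).+1 c.
Proof.
move=> ums X0; have /andP[ms us] := ums.
rewrite -(psum_cdf c us) -(psum_cdf c ums).
have mle s' : measurable [set w | (psum s' w <= c)%R].
  rewrite -[X in measurable X]setTI.
  by apply: measurable_fun_le => //; exact: measurable_psum.
rewrite (_ : [set w | _] = [set w | (psum s w <= c)%R] `\`
  [set w | (psum (m :: s) w <= c)%R]).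
  rewrite measureD// ?setIidr//.
    by move=> w /=; rewrite psum_cons; apply: le_trans; rewrite lerDr.
  by rewrite -ge0_fin_numE// fin_num_measure.
apply/seteqP; split=> w /=; rewrite psum_cons addrC ltNge.
  by move=> /andP[-> /negP].
by move=> [-> /negP].
Qed.

(** The difference is a straddling probability. *)
Lemma cdf_conv_decr n x : (forall k w, 0 <= X k w)%R ->
  0 <= cdf_conv F n x - cdf_conv F n.+1 x.
Proof.
move=> X0; have := @psum_straddle n (iota 0 n) x.
rewrite size_iota => <- //=; by rewrite iota_uniq mem_iota/= ltnn.
Qed.

(** The function is the cdf of an actual random variable, the sum of the first [n] terms. *)
Lemma measurable_cdf_conv n : measurable_fun setT (cdf_conv F n).
Proof.
have mY : measurable_fun setT (psum (iota 0 n) : T -> R).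
  exact: (measurable_psum (iota 0 n)).
pose Y : {mfun T >-> R} := HB.pack (psum (iota 0 n) : T -> R)
  (isMeasurableFun.Build _ _ _ _ _ mY).
have -> : cdf_conv F n = cdf (P := P) Y.
  apply/funext => x.
  transitivity (P [set w | (psum (iota 0 n) w <= x)%R]).
    by rewrite psum_cdf ?iota_uniq// size_iota.
  by congr (P _); apply/seteqP; split=> w /=; rewrite in_itv.
exact: cdf_measurable.
Qed.

(* [psum s] and [psum s + X m] are two consecutive epochs of the renewal
   process with inter-arrival times [X]. *)
Lemma psum_straddle_joint d' (E : measurableType d') (W : {mfun T >-> E})
    (phi : E -> R) (C : set E) m s :
  uniq (m :: s) -> (forall k w, 0 <= X k w)%R ->
  (forall A B, measurable A -> sigma_seq X B ->
     P (W @^-1` A `&` B) = P (W @^-1` A) * P B) ->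
  measurable_fun setT phi -> measurable C ->
  P [set w | C (W w) /\ (psum s w <= phi (W w) < psum s w + X m w)%R] =
  \int[distribution P W]_(x in C)
     (cdf_conv F (size s) (phi x) - cdf_conv F (size s).+1 (phi x)).
Proof.
move=> ums X0 indW mphi mC; have /andP[ms us] := ums.
(* [W] and the pair of epochs [V] are independent, so the event is measured by the product of their
   laws; its section at [W = x] is a straddling event with the constant [phi x]. *)
pose V w := (psum s w, psum (m :: s) w).
have mV : measurable_fun setT V.
  by apply/measurable_fun_pair; exact: measurable_psum.
pose Vm : {mfun T >-> (mR * mR)%type} :=
  HB.pack V (isMeasurableFun.Build _ _ _ _ _ mV).
have sV B : measurable B -> sigma_seq X (V @^-1` B).
  move=> mB; rewrite -(setTI (V @^-1` B)).
  pose T' := g_sigma_algebraType (\bigcup_k sigma_rv (X k)).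
  suff: measurable_fun setT (V : T' -> (mR * mR)%type) by apply.
  apply/measurable_fun_pair => _ B' mB'; rewrite setTI; exact: sigma_psum.
pose D := [set z : E * (mR * mR) | C z.1 /\ ((z.2.1 : R) <= phi z.1 < (z.2.2 : R))%R].
have mD : measurable D.
  have -> : D = (fst @^-1` C) `&` ([set z | ((z.2.1 : R) <= phi z.1)%R]
      `&` ~` [set z | ((z.2.2 : R) <= phi z.1)%R]).
    apply/seteqP; split=> z; rewrite /D/= ltNge.
      by move=> [? /andP[? /negP]].
    by move=> [? [-> /negP ->]].
  have mphi1 : measurable_fun setT (fun z : E * (mR * mR) => phi z.1).
    exact: measurableT_comp.
  have m21 : measurable_fun setT (fun z : E * (mR * mR) => z.2.1).
    exact: (measurableT_comp measurable_fst measurable_snd).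
  have m22 : measurable_fun setT (fun z : E * (mR * mR) => z.2.2).
    exact: (measurableT_comp measurable_snd measurable_snd).
  apply: measurableI; first by rewrite -[X in measurable X]setTI; exact: measurable_fst.
  apply: measurableI; last apply: measurableC.
    by rewrite -[X in measurable X]setTI; exact: measurable_fun_le.
  by rewrite -[X in measurable X]setTI; exact: measurable_fun_le.
transitivity (P [set w | D (W w, Vm w)]).
  by congr (P _); apply/seteqP; split=> w /=; rewrite /D/= psum_cons addrC.
rewrite indep_rv_joint//; last by move=> A B mA mB; rewrite indW//; exact: sV.
rewrite /product_measure1 [RHS]integral_mkcond; apply: eq_integral => x _.
rewrite patchE; case: ifPn => [/set_mem Cx|].
  rewrite -(psum_straddle (phi x) ums (X0 m)); congr (P _); apply/seteqP.
  split=> w /=; rewrite /xsection/= inE/= /D/= psum_cons addrC.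
    by case.
  by split.
rewrite notin_setE => Cx; rewrite -[RHS](measure0 (distribution P Vm)).
congr (distribution P Vm _); apply/seteqP; split=> // z.
by rewrite /xsection/= inE => -[].
Qed.

End partial_sums.

Section sigma_seq.
Context d (T : measurableType d) (R : realType) (P : probability T R).
Variable X : nat -> {RV P >-> R}.

Lemma sigma_seq_setT : sigma_seq X setT.
Proof. exact: (@measurableT _ (g_sigma_algebraType (\bigcup_k sigma_rv (X k)))). Qed.

Lemma sigma_seq_setI : setI_closed (sigma_seq X).
Proof. exact: (@measurableI _ (g_sigma_algebraType (\bigcup_k sigma_rv (X k)))). Qed.

Lemma sigma_seq_measurable : sigma_seq X `<=` measurable.
Proof.
apply: smallest_sub; first exact: sigma_algebra_measurable.
by move=> A [k _]; exact: sigma_rv_measurable.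
Qed.

End sigma_seq.

(** * Straddling events built from several independent sequences *)

Section independent_sequences.
Context d (T : measurableType d) (R : realType) (P : probability T R).
Context (I : choiceType) (Y : I -> nat -> {RV P >-> R}).
Local Notation mR := (measurableTypeR R).
Local Open Scope ereal_scope.

Let sig i := sigma_seq (Y i).
Let gsig (J : set I) := <<s \bigcup_(i in J) sig i >>.

Hypothesis indepY : mutually_independent P sig.

Let indep_gsig (J K : set I) A B : [disjoint J & K]%classic ->
  gsig J A -> gsig K B -> P (A `&` B) = P A * P B.
Proof.
apply: (mutually_independent_groups indepY) => i.
- exact: sigma_seq_setT.
- exact: sigma_seq_setI.
- exact: sigma_seq_measurable.
Qed.

Let sub_gsig (J : set I) i A : J i -> sigma_seq (Y i) A -> gsig J A.
Proof. by move=> Ji iA; apply: sub_sigma_algebra; exists i. Qed.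

Let measurable_gsig_psum (J : set I) i s : J i ->
  measurable_fun setT (psum (Y i) s : g_sigma_algebraType (\bigcup_(i in J) sig i) -> mR).
Proof.
move=> Ji _ B mB; rewrite setTI; apply: (sub_gsig Ji).
exact: sigma_psum.
Qed.

(** The roles are left open because they change with the state: [c] is the sequence whose sums
    straddle, namely [U] in state 0 and [S] in state 1, [a] and [b] supply the coordinates, and [x]
    is the sequence [xi]. *)
Lemma psum_straddle_indep (a b c x : I) (F : cumulativeBounded (0 : R) (1 : R))
    (f : R -> R) (phi : mR * mR -> R) (C : set (mR * mR)) A sa sb m sc :
  uniq [:: a; b; c; x] -> independent_rvs (Y c) ->
  (forall k, has_cdf_pdf (Y c k) F f) -> (forall k w, (0 <= Y c k w)%R) ->
  measurable_fun setT phi -> measurable C -> sigma_seq (Y x) A -> uniq (m :: sc) ->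
  let E := [set w | let z := (psum (Y a) sa w, psum (Y b) sb w) in
    C z /\ (psum (Y c) sc w <= phi z < psum (Y c) sc w + Y c m w)%R] in
  measurable E /\ P (A `&` E) = P A *
  \int[distribution P (psum (Y a) sa) \x distribution P (psum (Y b) sb)]_(z in C)
     (cdf_conv F (size sc) (phi z) - cdf_conv F (size sc).+1 (phi z)).
Proof.
rewrite /= !inE !negb_or => /and4P[/and3P[ab ac ax] /andP[bc bx] cx _].
move=> indc lawc Yc0 mphi mC xA ums; have /andP[ms us] := ums.
pose W w : mR * mR := (psum (Y a) sa w, psum (Y b) sb w).
have mW : measurable_fun setT W.
  by apply/measurable_fun_pair; exact: measurable_psum.
pose Wm : {mfun T >-> (mR * mR)%type} :=
  HB.pack W (isMeasurableFun.Build _ _ _ _ _ mW).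
set E := (E in measurable E).
(* [E] belongs to the sigma-algebra of the sequences [a], [b], [c], which is what makes it
   independent of [A]. *)
have gE : gsig [set a; b; c] E.
  pose T' := g_sigma_algebraType (\bigcup_(i in [set a; b; c]) sig i).
  have ma : measurable_fun setT (psum (Y a) sa : T' -> mR).
    by apply: measurable_gsig_psum; left; left.
  have mb : measurable_fun setT (psum (Y b) sb : T' -> mR).
    by apply: measurable_gsig_psum; left; right.
  have mc s : measurable_fun setT (psum (Y c) s : T' -> R).
    by apply: (measurable_gsig_psum s); right.
  have mW' : measurable_fun setT (W : T' -> (mR * mR)%type).
    exact: (measurable_fun_pair ma mb).
  have mphiW : measurable_fun setT (phi \o (W : T' -> (mR * mR)%type)).
    exact: measurableT_comp.
  have mle : measurable_fun setT (fun w : T' => psum (Y c) sc w <= phi (W w))%R.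
    exact: (measurable_fun_ler (mc sc) mphiW).
  have mgt : measurable_fun setT (fun w : T' => psum (Y c) (m :: sc) w <= phi (W w))%R.
    exact: (measurable_fun_ler (mc (m :: sc)) mphiW).
  have -> : E =
      (setT `&` W @^-1` C) `&` ((setT `&`
        (fun w => psum (Y c) sc w <= phi (W w))%R @^-1` [set true]) `&`
       ~` (setT `&`
        (fun w => psum (Y c) (m :: sc) w <= phi (W w))%R @^-1` [set true])).
    apply/seteqP; split => w; rewrite /E/= psum_cons addrC ltNge -/(W w).
      by move=> [Cw /andP[-> /negP sw]]; do 2 split => //; case.
    move=> [[_ Cw] [[_ ->] /= sw]]; split => //=.
    by apply/negP => h; exact: sw.
  apply: (@measurableI _ T'); first exact: mW'.
  apply: (@measurableI _ T'); first exact: mle.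
  by apply: (@measurableC _ T'); exact: mgt.
split.
  move: gE; apply: smallest_sub; first exact: sigma_algebra_measurable.
  by move=> B [i _]; exact: sigma_seq_measurable.
rewrite (@indep_gsig [set x] [set a; b; c])//; last 2 first.
- apply/disj_set2P; rewrite -subset0 => _ [-> [[]|]]; apply/eqP.
  + by rewrite eq_sym.
  + by rewrite eq_sym.
  + by rewrite eq_sym.
- exact: (@sub_gsig _ x).
congr (_ * _).
rewrite (psum_straddle_joint indc lawc (W := Wm) ums)//; last first.
  move=> A' B mA' cB; apply: (@indep_gsig [set a; b] [set c]).
  - apply/disj_set2P; rewrite -subset0 => _ [[-> | ->] /=]; exact/eqP.
  - pose T' := g_sigma_algebraType (\bigcup_(i in [set a; b]) sig i).
    rewrite -(setTI (W @^-1` A')).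
    suff: measurable_fun setT (W : T' -> (mR * mR)%type) by apply.
    apply/measurable_fun_pair; apply: measurable_gsig_psum; first by left.
    by right.
  - exact: (@sub_gsig _ c).
(* It remains to see that the law of the pair [W] is a product, by independence of [a] and [b]. *)
apply: eq_measure_integral => D mD _.
apply: (indep_rv_joint (X := psum (Y a) sa) (Y := psum (Y b) sb)) => //.
move=> A' B' mA' mB'.
apply: (@indep_gsig [set a] [set b]).
- apply/disj_set2P; rewrite -subset0 => _ [-> /=]; exact/eqP.
- by apply: (@sub_gsig _ a) => //; exact: sigma_psum.
- by apply: (@sub_gsig _ b) => //; exact: sigma_psum.
Qed.

End independent_sequences.

(** * Epochs and occupation times along one path *)

Section pathwise.
Context d (T : measurableType d) (R : realType) (U S L xi : nat -> T -> R).
Hypotheses (U_ge0 : forall k w, 0 <= U k w) (S_ge0 : forall k w, 0 <= S k w)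
  (L_ge0 : forall k w, 0 <= L k w).
Variable w : T.

Local Notation even n := (even_epoch U S L xi n w).
Local Notation odd n := (odd_epoch U S L xi n w).
Local Notation off n := (off_time S L xi n w).
Local Notation X := (onoff U S L xi w).

Lemma off_time_ge0 n : 0 <= off n.
Proof. by rewrite /off_time; case: ifP. Qed.

Lemma even_le_odd n : even n <= odd n.
Proof. by rewrite /odd_epoch lerDl. Qed.

Lemma odd_le_even n : odd n <= even n.+1.
Proof. by rewrite /= lerDl off_time_ge0. Qed.

Lemma le_even_epoch m n : (m <= n)%N -> even m <= even n.
Proof.
move=> mn; rewrite -(subnK mn); elim: (n - m)%N => [//|k IH].
by rewrite addSn (le_trans IH)// (le_trans (even_le_odd _)) ?odd_le_even.
Qed.

Lemma even_epoch_ge0 n : 0 <= even n.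
Proof. exact: (@le_even_epoch 0). Qed.

Lemma even_epochE n : even n = \sum_(i < n) U i w + \sum_(i < n) off i.
Proof.
elim: n => [|n IH]; first by rewrite !big_ord0 addr0.
by rewrite /= IH !big_ord_recr/=; ring.
Qed.

Lemma epoch_index s i j : even i <= s < even i.+1 -> even j <= s < even j.+1 ->
  i = j.
Proof.
wlog ij : i j / (i <= j)%N.
  move=> h si sj; have [ij|/ltnW ji] := leqP i j; first exact: h.
  exact/esym/h.
move=> /andP[_ si] /andP[js _]; apply/eqP; rewrite eqn_leq ij leqNgt/=.
by apply/negP => /le_even_epoch /le_trans/(_ js); rewrite leNgt si.
Qed.

Lemma on_epoch s i : even i <= s < odd i -> even i <= s < even i.+1.
Proof. by move=> /andP[-> /lt_le_trans]; apply; exact: odd_le_even. Qed.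

Lemma off_epoch s i : odd i <= s < even i.+1 -> even i <= s < even i.+1.
Proof. by move=> /andP[+ ->]; rewrite andbT; apply: le_trans; exact: even_le_odd. Qed.

Lemma onoff0P s : X s = 0%N <-> exists i, even i <= s < odd i.
Proof.
rewrite /onoff; case: asboolP => // h; split => [|/h//].
by do 2 case: asboolP => _ //.
Qed.

(** The comparison with [c == 1] handles both off-states at once. As [onoff] tries the states in a
    fixed order, the converse has to exclude the earlier branches, which follows from the
    disjointness of cycles. *)
Lemma onoff_offP c s : (c == 1%N) || (c == 2%N) -> X s = c <->
  exists2 i, (xi i w == 1) = (c == 1%N) & odd i <= s < even i.+1.
Proof.
move=> c12.
have on_off i j : even i <= s < odd i -> odd j <= s < even j.+1 -> False.
  move=> si sj; have ij := epoch_index (on_epoch si) (off_epoch sj); subst j.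
  case/andP: si => _ s1; case/andP: sj => s2 _.
  by have := lt_le_trans s1 s2; rewrite ltxx.
rewrite /onoff; case: asboolP => [[i si]|_].
  split=> [c0|[j _ sj]]; first by rewrite -c0 in c12.
  by have := on_off _ _ si sj.
case: asboolP => [[i xi1 si]|h1].
  split=> [<-|[j xj sj]]; first by exists i => //; rewrite xi1 !eqxx.
  have ij := epoch_index (off_epoch si) (off_epoch sj); subst j.
  by move: xj; rewrite xi1 eqxx => /esym/eqP.
case: asboolP => [[i xi1 si]|h2].
  split=> [<-|[j xj sj]]; first by exists i => //; rewrite (introF eqP xi1).
  have ij := epoch_index (off_epoch si) (off_epoch sj); subst j.
  move: xj c12; rewrite (introF eqP xi1).
  by move=> <-/= /eqP.
split=> [c3|[j xj sj]]; first by rewrite -c3 in c12.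
case/orP: c12 xj => /eqP ->.
  by move=> /eqP xj; case: h1; exists j.
by move=> /eqP xj; case: h2; exists j.
Qed.

(** On [[0, t]] the indicator of state [c] is a sum of indicators of disjoint off-periods, all with
    index below [N]. The difference of minima is the length of such a period cut at [t], and is 0 if
    the period starts after [t]. *)
Lemma occupationE c t N : (c == 1%N) || (c == 2%N) -> t < even N ->
  occupation U S L xi c t w =
  \sum_(i < N | (xi i w == 1) == (c == 1%N))
     (Num.min (even i.+1) t - Num.min (odd i) t).
Proof.
move=> c12 tN.
have indE s : s \in `[0, t]%classic -> ((\1_[set s | X s = c] s : R)%:E =
    \sum_(i < N | (xi i w == 1%R) == (c == 1%N))
      (\1_(`[odd i, even i.+1[%classic) s)%:E)%E.
  rewrite inE/= in_itv/= => /andP[s0 st].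
  have [/(onoff_offP s c12) [i xc si]|Xs] := pselect (X s = c).
    have iN : (i < N)%N.
      rewrite ltnNge; apply/negP => /le_even_epoch Ni.
      have /andP[i_s _] := off_epoch si.
      by have := le_lt_trans (le_trans Ni (le_trans i_s st)) tN; rewrite ltxx.
    rewrite indicE mem_set; last by apply/onoff_offP => //; exists i.
    rewrite (bigD1 (Ordinal iN)) ?xc//= indicE mem_set/= ?in_itv//=.
    rewrite big1 ?adde0// => j /andP[_ ji]; rewrite indicE memNset//= in_itv/= => sj.
    move/eqP: ji; apply; apply: val_inj => /=.
    exact: epoch_index (off_epoch sj) (off_epoch si).
  rewrite indicE memNset//= big1// => i /eqP xc.
  rewrite indicE memNset//= in_itv/= => si; apply: Xs.
  by apply/onoff_offP => //; exists i.
rewrite /occupation /Rintegral.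
under eq_integral => s sI do rewrite (indE s sI).
under eq_integral do rewrite -big_filter.
rewrite ge0_integral_sum//; last first.
  by move=> i; apply/measurable_EFinP; exact: measurable_funTS.
rewrite big_filter -[RHS]/(fine (_%:E)) -sumEFin; congr fine.
apply: eq_bigr => i _; rewrite integral_indic//.
have oe := odd_le_even i.
have o0 : 0 <= odd i by exact: le_trans (even_epoch_ge0 i) (even_le_odd i).
set a := odd i in oe o0 *; set b := even_epoch _ _ _ _ i.+1 w in oe *.
have [tb|bt] := ltP t b.
  have -> : `[a, b[ `&` `[0, t] = `[a, t]%classic.
    apply/seteqP; split => s /=; rewrite !in_itv/=.
      by move=> [/andP[-> _] /andP[_ ->]].
    move=> /andP[as_ st]; rewrite as_ st (le_lt_trans st tb).
    by rewrite (le_trans o0 as_).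
  rewrite [LHS](lebesgue_measure_itv `[a, t])/= lte_fin; case: ltP => [_|_].
    by rewrite -EFinB.
  by rewrite subrr.
rewrite (min_l (le_trans oe bt)).
have -> : `[a, b[ `&` `[0, t] = `[a, b[%classic.
  apply/seteqP; split => s /=; rewrite !in_itv/=; first by case.
  move=> /andP[as_ sb]; rewrite as_ sb (le_trans o0 as_).
  by rewrite (le_trans (ltW sb) bt).
rewrite [LHS](lebesgue_measure_itv `[a, b[)/= lte_fin; case: ltP => // ba.
by rewrite (@le_anti _ _ a b) ?subrr// oe ba.
Qed.

Lemma occupation_on c t n : (c == 1%N) || (c == 2%N) -> even n <= t < odd n ->
  occupation U S L xi c t w = \sum_(i < n | (xi i w == 1) == (c == 1%N)) off i.
Proof.
move=> c12 /andP[nt tn]; rewrite (@occupationE c t n.+1)//; last first.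
  exact: lt_le_trans tn (odd_le_even n).
(* The bound [t < even N] forces [N = n.+1]; the additional off-period begins after [t], so both
   minima equal [t]. *)
rewrite big_mkcond big_ord_recr/= [X in _ + X](_ : _ = 0) ?addr0; last first.
  case: ifP => // _; rewrite !min_r ?subrr// ?ltW//.
  exact: lt_le_trans tn (odd_le_even n).
rewrite -big_mkcond; apply: eq_bigr => i _.
have it : even i.+1 <= t by exact: le_trans (le_even_epoch (ltn_ord i)) nt.
rewrite (min_l it) (min_l (le_trans (odd_le_even i) it)).
by rewrite /= /odd_epoch addrAC subrr add0r.
Qed.

Lemma occupation_off c t n : (c == 1%N) || (c == 2%N) -> odd n <= t < even n.+1 ->
  occupation U S L xi c t w =
  \sum_(i < n | (xi i w == 1) == (c == 1%N)) off i +
  (if (xi n w == 1) == (c == 1%N) then t - odd n else 0).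
Proof.
move=> c12 /andP[nt tn]; rewrite (@occupationE c t n.+1)//.
rewrite big_mkcond big_ord_recr/=; congr (_ + _); last first.
  by case: ifP => // _; rewrite min_r ?min_l// ltW.
rewrite -big_mkcond; apply: eq_bigr => i _.
have it : even i.+1 <= t.
  exact: le_trans (le_even_epoch (ltn_ord i)) (le_trans (even_le_odd n) nt).
rewrite (min_l it) (min_l (le_trans (odd_le_even i) it)).
by rewrite /= /odd_epoch addrAC subrr add0r.
Qed.

End pathwise.

(** * Probability of a pattern of off-states *)

Section bernoulli_sequence.
Context d (T : measurableType d) (R : realType) (P : probability T R).
Variables (xi : nat -> {RV P >-> R}) (p1 p2 : R).
Hypotheses (indep_xi : independent_rvs xi) (p2E : p2 = 1 - p1)
  (xi1 : forall k, P [set w | xi k w = 1] = p1%:E).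

Definition xi_event n (b : nat -> bool) : set T :=
  [set w | forall j, (j < n)%N -> (xi j w == 1) = b j].

Let bit j c := [set w | (xi j w == 1) = c].

Let bit_sigma j c : sigma_rv (xi j) (bit j c).
Proof.
exists (if c then [set 1] else ~` [set 1]); first by case: c; [|apply: measurableC].
rewrite setTI; apply/seteqP; rewrite /bit; case: c; split => w /= xw.
- by rewrite xw eqxx.
- exact/eqP.
- by apply/eqP => /xw.
- by move/eqP: xw.
Qed.

Let P_bit j c : P (bit j c) = (if c then p1 else p2)%:E.
Proof.
have b1 : P (bit j true) = p1%:E.
  by rewrite -(xi1 j); congr (P _); apply/seteqP; split => w /= /eqP.
case: c => //; rewrite (_ : bit j false = ~` bit j true).
  rewrite probability_setC ?b1 ?p2E//.
  exact: (sigma_rv_measurable (bit_sigma j true)).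
by apply/seteqP; rewrite /bit; split => w /=; case: eqP => // _ /(_ erefl).
Qed.

Let xi_eventS n b : xi_event n.+1 b = bit n (b n) `&` xi_event n b.
Proof.
apply/seteqP; split => w /= h.
  by split; [exact: h|move=> j jn; apply: h; exact: ltnW].
by move=> j; rewrite ltnS leq_eqVlt => /predU1P[->|]; [case: h|case: h => _; exact].
Qed.

Let xi_event_gen n b :
  <<s \bigcup_(j in [set j | (j < n)%N]) sigma_rv (xi j) >> (xi_event n b).
Proof.
(* The sigma-algebra stays that of the first [n] variables while the induction runs over [m]. *)
have sub m : (m <= n)%N ->
    <<s \bigcup_(j in [set j | (j < n)%N]) sigma_rv (xi j) >> (xi_event m b).
  pose T' := g_sigma_algebraType
    (\bigcup_(j in [set j | (j < n)%N]) sigma_rv (xi j)).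
  elim: m => [_|m IH mn].
    rewrite (_ : xi_event 0 b = setT); first exact: (@measurableT _ T').
    by apply/seteqP; split.
  rewrite xi_eventS; apply: (@measurableI _ T'); last exact: (IH (ltnW mn)).
  by apply: sub_sigma_algebra; exists m.
exact: sub.
Qed.

Lemma sigma_xi_event n b : sigma_seq xi (xi_event n b).
Proof.
move: (@xi_event_gen n b); apply: sub_sigma_algebra2 => A [j _ jA].
by exists j.
Qed.

Lemma probability_xi_event n b :
  P (xi_event n b) = (\prod_(j < n) (if b j then p1 else p2))%:E.
Proof.
elim: n => [|n IH].
  rewrite big_ord0 -(@probability_setT _ _ _ P); congr (P _).
  by apply/seteqP; split.
rewrite xi_eventS big_ord_recr/= mulrC EFinM -(P_bit n (b n)) -IH.
apply: (mutually_independent_groups indep_xi (@sigma_rv_setT _ _ _ P xi)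
  (@sigma_rv_setI _ _ _ P xi) (@sigma_rv_measurable _ _ _ P xi)
  (J := [set n]) (K := [set j | (j < n)%N])).
- by apply/disj_set2P; rewrite -subset0 => j [/= ->]; rewrite ltnn.
- by apply: sub_sigma_algebra; exists n.
- exact: xi_event_gen.
Qed.

End bernoulli_sequence.

(** * Sums and products over subsets of indices *)

Section subsets.
Variable n : nat.
Implicit Type e : {set 'I_n}.

Definition set_indices e : seq nat := [seq val i | i <- enum e].

Lemma set_indices_uniq e : uniq (set_indices e).
Proof. by rewrite (map_inj_uniq val_inj) enum_uniq. Qed.

Lemma size_set_indices e : size (set_indices e) = #|e|.
Proof. by rewrite size_map -cardE. Qed.

Lemma mem_set_indices e (i : 'I_n) : (val i \in set_indices e) = (i \in e).
Proof. by rewrite (mem_map val_inj) mem_enum. Qed.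

Lemma set_indices_lt e j : j \in set_indices e -> (j < n)%N.
Proof. by case/mapP => i _ ->; exact: ltn_ord. Qed.

Lemma notin_set_indices e : n \notin set_indices e.
Proof. by apply/negP => /set_indices_lt; rewrite ltnn. Qed.

Lemma sum_subsets (V : nmodType) (g : nat -> V) :
  \sum_(e : {set 'I_n}) g #|e| = \sum_(k < n.+1) g k *+ 'C(n, k).
Proof.
(* The cardinal is at most [n], so [inord] keeps its value. *)
rewrite (partition_big (fun e : {set 'I_n} => inord #|e| : 'I_n.+1) predT)//=.
apply: eq_bigr => k _.
have cardk (e : {set 'I_n}) : (inord #|e| == k) = (#|e| == k).
  have en : (#|e| < n.+1)%N by rewrite ltnS; have := max_card (mem e); rewrite card_ord.
  by rewrite -val_eqE/= inordK.
under eq_bigl do rewrite cardk.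
rewrite (eq_bigr (fun=> g k)); last by move=> e /eqP ->.
rewrite sumr_const; congr (_ *+ _).
have := card_draws 'I_n k; rewrite card_ord => <-; apply: eq_card => e.
by rewrite !inE.
Qed.

Lemma prod_set_indices (R : comPzRingType) (x y : R) e :
  \prod_(j < n) (if val j \in set_indices e then x else y) =
  x ^+ #|e| * y ^+ (n - #|e|).
Proof.
under eq_bigr do rewrite mem_set_indices.
rewrite (bigID (mem e))/=; congr (_ * _).
  by rewrite (eq_bigr (fun=> x)) ?prodr_const// => i ->.
rewrite (eq_bigr (fun=> y)); last by move=> i /negbTE ->.
rewrite prodr_const; congr (_ ^+ _).
by rewrite -[X in (X - _)%N](card_ord n) -(cardC (mem e)) addKn.
Qed.

End subsets.

Section finite_bigcup.
Context d (T : measurableType d) (R : realType) (P : {measure set T -> \bar R}).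

Lemma measure_bigcup_finType (I : finType) (F : I -> set T) :
  (forall i, measurable (F i)) -> trivIset setT F ->
  P (\bigcup_i F i) = (\sum_i P (F i))%E.
Proof.
move=> mF tF; rewrite measure_fin_bigcup//; last exact: finite_finset.
rewrite (fsbigE (index_enum I)) ?index_enum_uniq//; last first.
  by move=> i _; rewrite mem_index_enum.
by apply: eq_bigl => i; apply/asboolP.
Qed.

End finite_bigcup.

(** * Integrals against product laws, series of densities, reflection of the plane *)

Section product_integrals.
Local Open Scope ereal_scope.
Context d1 d2 (E1 : measurableType d1) (E2 : measurableType d2) (R : realType).

(** Discards terms for two opposite reasons: an empty sum gives no mass to the complement of 0, a
    nonempty one gives no mass to 0. *)
Lemma integral_null_rectangle (m1 : {measure set E1 -> \bar R})
    (m2 : {sigma_finite_measure set E2 -> \bar R}) (A1 : set E1) (A2 : set E2)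
    (C : set (E1 * E2)) (h : E1 * E2 -> \bar R) :
  measurable A1 -> measurable A2 -> C `<=` A1 `*` A2 -> measurable C ->
  m1 A1 = 0 \/ m2 A2 = 0 -> measurable_fun setT h ->
  \int[m1 \x m2]_(z in C) h z = 0.
Proof.
move=> mA1 mA2 CA mC A0 mh; apply: null_set_integral => //.
  exact: measurable_funTS.
apply/eqP; rewrite eq_le measure_ge0 andbT.
apply: (@le_trans _ _ ((m1 \x m2) (A1 `*` A2))).
  by apply: le_measure => //; rewrite inE//; exact: measurableX.
rewrite product_measure1E//.
by case: A0 => ->; rewrite ?mule0 ?mul0e.
Qed.

Lemma integral_product_density (mu1 nu1 : {sigma_finite_measure set E1 -> \bar R})
    (mu2 nu2 : {sigma_finite_measure set E2 -> \bar R})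
    (q1 : E1 -> \bar R) (q2 : E2 -> \bar R)
    (C : set (E1 * E2)) (h : E1 * E2 -> \bar R) :
  measurable_fun setT q1 -> (forall x, 0 <= q1 x) ->
  (forall A, measurable A -> nu1 A = \int[mu1]_(x in A) q1 x) ->
  measurable_fun setT q2 -> (forall x, 0 <= q2 x) ->
  (forall A, measurable A -> nu2 A = \int[mu2]_(x in A) q2 x) ->
  measurable C -> measurable_fun setT h -> (forall z, 0 <= h z) ->
  \int[nu1 \x nu2]_(z in C) h z = \int[mu1 \x mu2]_(z in C) (h z * q1 z.1 * q2 z.2).
Proof.
move=> mq1 q10 nu1E mq2 q20 nu2E mC mh h0.
pose k z := h z * (\1_C z)%:E.
have k0 z : 0 <= k z by rewrite mule_ge0// lee_fin.
have mk : measurable_fun setT k.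
  by apply: emeasurable_funM => //; exact/measurable_EFinP.
have mkx x : measurable_fun setT (fun y => k (x, y)).
  by apply: (measurableT_comp mk); exact: measurable_pair1.
have mq2s : measurable_fun setT (fun z : E1 * E2 => q2 z.2).
  by apply: (measurableT_comp mq2); exact: measurable_snd.
have mq1f : measurable_fun setT (fun z : E1 * E2 => q1 z.1).
  by apply: (measurableT_comp mq1); exact: measurable_fst.
have kq0 z : 0 <= k z * q2 z.2 by rewrite mule_ge0.
have mkq : measurable_fun setT (fun z => k z * q2 z.2).
  exact: emeasurable_funM.
rewrite [LHS]integral_mkcond epatch_indic -/k.
rewrite [RHS]integral_mkcond epatch_indic.
rewrite (fubini_tonelli1 (m1 := nu1) (m2 := nu2) k mk k0).
transitivity (\int[nu1]_x \int[mu2]_y (k (x, y) * q2 y)).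
  apply: eq_integral => x _.
  exact: (ge0_integral_density mq2 q20 nu2E (mkx x) (fun y => k0 (x, y))).
rewrite (ge0_integral_density mq1 q10 nu1E); last 2 first.
- exact: (measurable_fun_fubini_tonelli_F (m2 := mu2) _ mkq kq0).
- by move=> x; apply: integral_ge0 => y _; exact: kq0 (x, y).
pose l z := h z * q1 z.1 * q2 z.2 * (\1_C z)%:E.
have l0 z : 0 <= l z by rewrite !mule_ge0// lee_fin.
have ml : measurable_fun setT l.
  apply: emeasurable_funM; last exact/measurable_EFinP.
  by apply: emeasurable_funM => //; exact: emeasurable_funM.
rewrite (fubini_tonelli1 (m1 := mu1) (m2 := mu2) l ml l0).
apply: eq_integral => x _; rewrite -ge0_integralZr//; last first.
  exact: emeasurable_funM (mkx x) mq2.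
apply: eq_integral => y _; rewrite /k /l/=.
by rewrite -!muleA; congr (_ * _); rewrite [RHS]muleCA muleC -muleA [q2 y * _]muleC.
Qed.

End product_integrals.

Section series_density.
Local Open Scope ereal_scope.
Context d (E : measurableType d) (R : realType).

Lemma is_density_nneseries (mu : {measure set E -> \bar R}) (D : set E)
    (m : set E -> \bar R) (g : nat -> E -> \bar R) :
  measurable D -> (forall n, measurable_fun D (g n)) ->
  (forall n x, D x -> 0 <= g n x) ->
  (forall B, measurable B -> B `<=` D ->
     m B = \sum_(0 <= n <oo) \int[mu]_(x in B) g n x) ->
  is_density mu D m (fun x => \sum_(0 <= n <oo) g n x).
Proof.
move=> mD mg g0 mE; split.
- by apply: ge0_emeasurable_sum => // k x Dx _; exact: g0.
- by move=> x Dx; apply: nneseries_ge0 => n _ _; exact: g0.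
- move=> B mB BD; rewrite mE// integral_nneseries//.
    by move=> n; apply: measurable_funS (mg n).
  by move=> n x /BD; exact: g0.
Qed.

Lemma nneseries_from1 (u : (\bar R)^nat) : (forall n, 0 <= u n) -> u 0%N = 0 ->
  \sum_(1 <= n <oo) u n = \sum_(0 <= n <oo) u n.
Proof. by move=> u0 u00; rewrite nneseries_recl// u00 add0e. Qed.

End series_density.

Section reflection_plane.
Local Open Scope ereal_scope.
Context {R : realType}.
Local Notation mR := (measurableTypeR R).
Local Notation mu := (@lebesgue_measure R).

(** For fixed second coordinate [y] the map is the reflection of the line with constant [t - y];
    Tonelli does the rest. *)
Lemma ge0_integral_plane_reflection (t : R) (H : mR * mR -> \bar R) :
  measurable_fun setT H -> (forall z, 0 <= H z) ->
  \int[mu \x mu]_z H ((t - (z.1 : R) - (z.2 : R))%R, z.2) = \int[mu \x mu]_z H z.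
Proof.
move=> mH H0.
have mr : measurable_fun setT (fun z : mR * mR => (t - (z.1 : R) - (z.2 : R))%R).
  have m1 : measurable_fun setT (fun z : mR * mR => z.1 : R) by exact: measurable_fst.
  have m2 : measurable_fun setT (fun z : mR * mR => z.2 : R) by exact: measurable_snd.
  exact: measurable_funB (measurable_funB (measurable_cst t) m1) m2.
have mHr : measurable_fun setT
    (fun z : mR * mR => H ((t - (z.1 : R) - (z.2 : R))%R, z.2)).
  apply: (measurableT_comp mH); apply/measurable_fun_pair; first exact: mr.
  exact: measurable_snd.
rewrite (fubini_tonelli2 (m1 := mu) (m2 := mu))//.
rewrite (fubini_tonelli2 (m1 := mu) (m2 := mu) H)//.
apply: eq_integral => y _; rewrite /fubini_G/=.
have mHy : measurable_fun setT (fun x : mR => H (x, y)).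
  by apply: (measurableT_comp mH); exact: measurable_pair2.
rewrite -(ge0_integral_reflection (t - (y : R)) (h := fun x => H (x, y)))//.
by apply: eq_integral => x _; congr (H (_, _)); rewrite addrAC.
Qed.

End reflection_plane.

(** * Joint laws of the occupation times in states 0 and 1 *)

Section occupation_laws.
Context d (T : measurableType d) (R : realType) (P : probability T R).
Variables (U S L xi : nat -> {RV P >-> R}).
Variables (F_U F_S F_L : cumulativeBounded (0 : R) (1 : R)) (f_U f_S f_L : R -> R).
Variables (p1 p2 : R).
Hypotheses (U_ge0 : forall k w, 0 <= U k w) (S_ge0 : forall k w, 0 <= S k w)
  (L_ge0 : forall k w, 0 <= L k w).
Hypotheses (U_iid : independent_rvs U) (S_iid : independent_rvs S)
  (L_iid : independent_rvs L) (xi_iid : independent_rvs xi)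
  (indep : independent_seqs4 U S L xi).
Hypotheses (U_law : forall k, has_cdf_pdf (U k) F_U f_U)
  (S_law : forall k, has_cdf_pdf (S k) F_S f_S)
  (L_law : forall k, has_cdf_pdf (L k) F_L f_L).
Hypotheses (p2E : p2 = 1 - p1) (xi1 : forall k, P [set w | xi k w = 1] = p1%:E).
Variable t : R.

Local Notation mR := (measurableTypeR R).
Local Notation X := (onoff U S L xi).
Local Notation St := (occupation U S L xi 1 t).
Local Notation Lt := (occupation U S L xi 2 t).
Local Notation even n w := (even_epoch U S L xi n w).
Local Notation odd n w := (odd_epoch U S L xi n w).
Local Notation off n w := (off_time S L xi n w).

(** The time left for the third family of sums: for the sum of [U] when [z] holds the sums of [S]
    and [L], for time in state 1 when [z] holds those of [U] and [L]. *)
Let rest (z : mR * mR) : R := t - (z.1 : R) - (z.2 : R).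

Let measurable_rest : measurable_fun setT rest.
Proof.
have m1 : measurable_fun setT (fun z : mR * mR => z.1 : R) by exact: measurable_fst.
have m2 : measurable_fun setT (fun z : mR * mR => z.2 : R) by exact: measurable_snd.
by apply: measurable_funB => //; exact: measurable_funB.
Qed.

Section pattern.
Variables (n : nat) (e : {set 'I_n}) (w : T).
Hypothesis xi_e : xi_event xi n [in set_indices e] w.

Let s := set_indices e.
Let s' := set_indices (~: e).

Let xiE (i : 'I_n) : (xi i w == 1) = (i \in e).
Proof. by rewrite xi_e// mem_set_indices. Qed.

(** The filter is left as [occupation_on] and [occupation_off] produce it at [c = 1], so that it can
    be rewritten there. *)
Lemma sum_off1 : \sum_(i < n | (xi i w == 1) == (1 == 1)%N) off i w = psum S s w.
Proof.
rewrite /psum big_map big_enum/=.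
under eq_bigl do rewrite xiE eqxx eqb_id.
by apply: eq_bigr => i ie; rewrite /off_time xiE ie.
Qed.

Lemma sum_off2 : \sum_(i < n | (xi i w == 1) == (2 == 1)%N) off i w = psum L s' w.
Proof.
rewrite /psum big_map big_enum/=.
under eq_bigl do rewrite xiE eqbF_neg.
under [RHS]eq_bigl do rewrite inE.
by apply: eq_bigr => i /negbTE ie; rewrite /off_time xiE ie.
Qed.

Lemma even_epoch_psum :
  even n w = (psum U (iota 0 n) w : R) + (psum S s w : R) + (psum L s' w : R).
Proof.
rewrite even_epochE -addrA; congr (_ + _).
  by rewrite /psum -(big_mkord xpredT (fun i => U i w)) /index_iota subn0.
rewrite (bigID (fun i : 'I_n => xi i w == 1))/= -sum_off1 -sum_off2.
congr (_ + _); apply: eq_bigl => i; first by rewrite eqxx eqb_id.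
by rewrite eqbF_neg.
Qed.

Lemma odd_epoch_psum :
  odd n w = (psum U (iota 0 n.+1) w : R) + (psum S s w : R) + (psum L s' w : R).
Proof.
rewrite /odd_epoch even_epoch_psum -addn1 iotaD add0n/=.
by rewrite [psum U (_ ++ _) w]/psum big_cat/= big_seq1 -/(psum U _ w); ring.
Qed.

End pattern.

Lemma xi_event_inj n (e e' : {set 'I_n}) w :
  xi_event xi n [in set_indices e] w -> xi_event xi n [in set_indices e'] w ->
  e = e'.
Proof.
move=> xe xe'; apply/setP => i; rewrite -!mem_set_indices.
exact: etrans (esym (xe i (ltn_ord i))) (xe' i (ltn_ord i)).
Qed.

Lemma xi_event_ex n w : exists e : {set 'I_n}, xi_event xi n [in set_indices e] w.
Proof.
exists [set i : 'I_n | xi i w == 1]%SET => j jn.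
by rewrite (mem_set_indices _ (Ordinal jn)) inE.
Qed.

Section on_state.
Variable C : set (mR * mR).
Hypothesis mC : measurable C.

(** The event that [t] lies in the on-period [n], expressed without epochs: a pattern of [xi] and a
    straddling event of the other sequences. *)
Let G n (e : {set 'I_n}) : set T := xi_event xi n [in set_indices e] `&`
  [set w | let z := (psum S (set_indices e) w, psum L (set_indices (~: e)) w) in
    C z /\ psum U (iota 0 n) w <= rest z < psum U (iota 0 n) w + U n w].

Let G_epoch n (e : {set 'I_n}) w : G e w -> even n w <= t < odd n w.
Proof.
move=> [xe /= [_]]; rewrite /odd_epoch (even_epoch_psum xe) /rest/=.
move=> /andP[h1 h2]; apply/andP; split; lra.
Qed.

Let on_eventE : [set w | C (St w, Lt w) /\ X w t = 0%N] =
  \bigcup_n \bigcup_(e : {set 'I_n}) G e.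
Proof.
apply/seteqP; split=> w /=.
  move=> [Cw /onoff0P[n nt]]; have [e xe] := xi_event_ex n w.
  move: Cw; rewrite !(occupation_on U_ge0 S_ge0 L_ge0 _ nt)//.
  rewrite (sum_off1 xe) (sum_off2 xe) => Cw.
  exists n => //; exists e => //; split => //; split => //.
  move: nt; rewrite /odd_epoch (even_epoch_psum xe) /rest/= => /andP[h1 h2].
  by apply/andP; split; lra.
move=> [n _ [e _ Gw]]; have nt := G_epoch Gw; have [xe [Cw _]] := Gw.
split; last by apply/onoff0P; exists n.
by rewrite !(occupation_on U_ge0 S_ge0 L_ge0 _ nt)// (sum_off1 xe) (sum_off2 xe).
Qed.

Let P_G n (e : {set 'I_n}) : measurable (G e) /\ P (G e) =
  ((p1 ^+ #|e| * p2 ^+ (n - #|e|))%:E *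
   \int[distribution P (psum S (iota 0 #|e|)) \x
        distribution P (psum L (iota 0 (n - #|e|)))]_(z in C)
     (cdf_conv F_U n (rest z) - cdf_conv F_U n.+1 (rest z)))%E.
Proof.
have ne : #|~: e| = (n - #|e|)%N by rewrite cardsCs finset.setCK card_ord.
have xe : sigma_seq xi (xi_event xi n [in set_indices e]).
  exact: sigma_xi_event.
(* Coordinates from [S] (1) and [L] (2), straddling by [U] (0), pattern from [xi] (3). *)
have := @psum_straddle_indep _ _ _ P _ (fun i : 'I_4 => nth U [:: U; S; L; xi] i)
  indep 1 2%:R 0 3%:R F_U f_U rest C _ (set_indices e) (set_indices (~: e))
  n (iota 0 n) isT U_iid U_law U_ge0 measurable_rest mC xe.
rewrite /= mem_iota ltnn andbF iota_uniq => /(_ isT) [mE PE].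
split; first by apply: measurableI => //; exact: (sigma_seq_measurable xe).
rewrite PE (probability_xi_event xi_iid p2E xi1) prod_set_indices size_iota.
congr (_ * _)%E; apply: eq_measure_integral => D mD _.
apply: eq_product_measure => // A mA.
  apply: (psum_distribution S_iid S_law) => //.
  - exact: set_indices_uniq.
  - exact: iota_uniq.
  - by rewrite size_set_indices size_iota.
apply: (psum_distribution L_iid L_law) => //.
- exact: set_indices_uniq.
- exact: iota_uniq.
- by rewrite size_set_indices size_iota.
Qed.

(** The union is disjoint in [n] because [t] lies in one cycle only, and in [e] because a path has
    one pattern. *)
Lemma on_state_law : P [set w | C (St w, Lt w) /\ X w t = 0%N] =
  (\sum_(0 <= n <oo) \sum_(0 <= k < n.+1)
    ('C(n, k)%:R * p1 ^+ k * p2 ^+ (n - k))%:E *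
    \int[distribution P (psum S (iota 0 k)) \x
         distribution P (psum L (iota 0 (n - k)))]_(z in C)
      (cdf_conv F_U n (rest z) - cdf_conv F_U n.+1 (rest z)))%E.
Proof.
rewrite on_eventE measure_semi_bigcup; last first.
- apply: bigcup_measurable => n _; apply: fin_bigcup_measurable => // e _.
  by have [] := P_G e.
- move=> m n _ _ [w [[e _ Ge] [e' _ Ge']]].
  exact: (epoch_index U_ge0 S_ge0 L_ge0 (on_epoch S_ge0 L_ge0 (G_epoch Ge))
    (on_epoch S_ge0 L_ge0 (G_epoch Ge'))).
- move=> n; apply: fin_bigcup_measurable => // e _.
  by have [] := P_G e.
apply: eq_eseriesr => n _; rewrite measure_bigcup_finType; last 2 first.
- by move=> e; have [] := P_G e.
- by move=> e e' _ _ [w [[xe _] [xe' _]]]; exact: xi_event_inj xe xe'.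
pose K k := ((p1 ^+ k * p2 ^+ (n - k))%:E *
   \int[distribution P (psum S (iota 0 k)) \x
        distribution P (psum L (iota 0 (n - k)))]_(z in C)
     (cdf_conv F_U n (rest z) - cdf_conv F_U n.+1 (rest z)))%E.
transitivity (\sum_(e : {set 'I_n}) K #|e|)%E.
  by apply: eq_bigr => e _; exact: (P_G e).2.
rewrite (sum_subsets n K).
rewrite big_mkord; apply: eq_bigr => k _.
by rewrite -[LHS]/(enatmul (K k) 'C(n, k)) -mule_natl muleA -EFinM mulrA.
Qed.

End on_state.

Lemma measurable_off_set (C : set (mR * mR)) : measurable C ->
  measurable [set z : mR * mR | C (rest z, z.2)].
Proof.
move=> mC; have mh : measurable_fun setT (fun z : mR * mR => (rest z : mR, z.2)).
  by apply/measurable_fun_pair; [exact: measurable_rest|exact: measurable_snd].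
by rewrite -[X in measurable X]setTI; exact: mh.
Qed.

Section off_state.
Variable C : set (mR * mR).
Hypothesis mC : measurable C.

Let C' := [set z : mR * mR | C (rest z, z.2)].

Let mC' : measurable C' := measurable_off_set mC.

(** The first [n] bits follow [e]; bit [n] is 1 since the current off-period is spent in state 1. *)
Let b n (e : {set 'I_n}) j := (j \in set_indices e) || (j == n).

Let G n (e : {set 'I_n}) : set T := xi_event xi n.+1 (b e) `&`
  [set w | let z := (psum U (iota 0 n.+1) w, psum L (set_indices (~: e)) w) in
    C' z /\ psum S (set_indices e) w <= rest z < psum S (set_indices e) w + S n w].

Let G_xi n (e : {set 'I_n}) w : xi_event xi n.+1 (b e) w <->
  xi_event xi n [in set_indices e] w /\ xi n w = 1.
Proof.
split=> [xe|[xe xn] j].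
  split=> [j jn|]; first by have := xe j (ltnW jn); rewrite /b (ltn_eqF jn) orbF.
  by apply/eqP; have := xe n (ltnSn n); rewrite /b eqxx orbT.
rewrite ltnS leq_eqVlt /b => /predU1P[->|jn]; first by rewrite xn !eqxx orbT.
by rewrite (ltn_eqF jn) orbF; exact: xe j jn.
Qed.

Let even_epochS n (e : {set 'I_n}) w : xi n w = 1 ->
  even n.+1 w = odd n w + S n w.
Proof. by move=> xn; rewrite /= /off_time xn eqxx. Qed.

Let G_epoch n (e : {set 'I_n}) w : G e w -> odd n w <= t < even n.+1 w.
Proof.
move=> [/G_xi[xe xn] [_]]; rewrite (even_epochS e xn) (odd_epoch_psum xe) /rest/=.
by move=> /andP[h1 h2]; apply/andP; split; lra.
Qed.

(** The elapsed part [t - odd n] of the current period cancels the sum of the completed [S_i]. *)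
Let occupation1E n (e : {set 'I_n}) w : xi_event xi n [in set_indices e] w ->
  xi n w = 1 -> odd n w <= t < even n.+1 w ->
  St w = rest (psum U (iota 0 n.+1) w, psum L (set_indices (~: e)) w).
Proof.
move=> xe xn nt; rewrite (occupation_off U_ge0 S_ge0 L_ge0 _ nt)//.
by rewrite (sum_off1 xe) xn !eqxx (odd_epoch_psum xe) /rest/=; ring.
Qed.

Let occupation2E n (e : {set 'I_n}) w : xi_event xi n [in set_indices e] w ->
  xi n w = 1 -> odd n w <= t < even n.+1 w ->
  Lt w = psum L (set_indices (~: e)) w.
Proof.
move=> xe xn nt; rewrite (occupation_off U_ge0 S_ge0 L_ge0 _ nt)//.
by rewrite (sum_off2 xe) xn eqxx addr0.
Qed.

Let off_eventE :
  [set w | C (St w, Lt w) /\ X w t = 1%N] = \bigcup_n \bigcup_(e : {set 'I_n}) G e.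
Proof.
apply/seteqP; split=> w /=.
  move=> [Cw /(onoff_offP xi U_ge0 S_ge0 L_ge0 w t (c := 1) isT)[n /eqP xn nt]].
  have [e xe] := xi_event_ex n w.
  exists n => //; exists e => //; split; first exact/G_xi.
  split; first by move: Cw; rewrite (occupation1E xe xn nt) (occupation2E xe xn nt).
  move: nt; rewrite (even_epochS e xn) (odd_epoch_psum xe) /rest/= => /andP[h1 h2].
  by apply/andP; split; lra.
move=> [n _ [e _ Gw]]; have nt := G_epoch Gw; have [/G_xi[xe xn] [Cw _]] := Gw.
split; first by rewrite (occupation1E xe xn nt) (occupation2E xe xn nt).
apply/(onoff_offP xi U_ge0 S_ge0 L_ge0 w t (c := 1) isT).
by exists n => //; rewrite xn eqxx.
Qed.

Let P_G n (e : {set 'I_n}) : measurable (G e) /\ P (G e) =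
  ((p1 ^+ #|e|.+1 * p2 ^+ (n - #|e|))%:E *
   \int[distribution P (psum U (iota 0 n.+1)) \x
        distribution P (psum L (iota 0 (n - #|e|)))]_(z in C')
     (cdf_conv F_S #|e| (rest z) - cdf_conv F_S #|e|.+1 (rest z)))%E.
Proof.
have ne : #|~: e| = (n - #|e|)%N by rewrite cardsCs finset.setCK card_ord.
have xe : sigma_seq xi (xi_event xi n.+1 (b e)) by exact: sigma_xi_event.
(* Now the coordinates come from [U] (0) and [L] (2), and the sums of [S] (1) straddle. *)
have := @psum_straddle_indep _ _ _ P _ (fun i : 'I_4 => nth U [:: U; S; L; xi] i)
  indep 0 2%:R 1 3%:R F_S f_S rest C' _ (iota 0 n.+1) (set_indices (~: e))
  n (set_indices e) isT S_iid S_law S_ge0 measurable_rest mC' xe.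
rewrite cons_uniq notin_set_indices set_indices_uniq => /(_ isT) [mE PE].
split; first by apply: measurableI => //; exact: (sigma_seq_measurable xe).
rewrite PE (probability_xi_event xi_iid p2E xi1) big_ord_recr/= /b eqxx orbT.
(* Bit [n] has already contributed its own factor [p1], whence the exponent [#|e|.+1]. *)
rewrite (eq_bigr (fun j : 'I_n => if val j \in set_indices e then p1 else p2)).
  rewrite prod_set_indices size_set_indices mulrAC -exprSr.
  congr (_ * _)%E; apply: eq_measure_integral => D mD _.
  apply: eq_product_measure => // A mA.
  apply: (psum_distribution L_iid L_law) => //.
  - exact: set_indices_uniq.
  - exact: iota_uniq.
  - by rewrite size_set_indices size_iota.
by move=> j _; rewrite (ltn_eqF (ltn_ord j)) orbF.
Qed.

Lemma off_state_law : P [set w | C (St w, Lt w) /\ X w t = 1%N] =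
  (\sum_(0 <= n <oo) \sum_(0 <= k < n.+1)
    ('C(n, k)%:R * p1 ^+ k.+1 * p2 ^+ (n - k))%:E *
    \int[distribution P (psum U (iota 0 n.+1)) \x
         distribution P (psum L (iota 0 (n - k)))]_(z in C')
      (cdf_conv F_S k (rest z) - cdf_conv F_S k.+1 (rest z)))%E.
Proof.
rewrite off_eventE measure_semi_bigcup; last first.
- apply: bigcup_measurable => n _; apply: fin_bigcup_measurable => // e _.
  by have [] := P_G e.
- move=> m n _ _ [w [[e _ Ge] [e' _ Ge']]].
  exact: (epoch_index U_ge0 S_ge0 L_ge0 (off_epoch U_ge0 (G_epoch Ge))
    (off_epoch U_ge0 (G_epoch Ge'))).
- move=> n; apply: fin_bigcup_measurable => // e _.
  by have [] := P_G e.
apply: eq_eseriesr => n _; rewrite measure_bigcup_finType; last 2 first.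
- by move=> e; have [] := P_G e.
- move=> e e' _ _ [w [[/G_xi[xe _] _] [/G_xi[xe' _] _]]].
  exact: xi_event_inj xe xe'.
pose K k := ((p1 ^+ k.+1 * p2 ^+ (n - k))%:E *
   \int[distribution P (psum U (iota 0 n.+1)) \x
        distribution P (psum L (iota 0 (n - k)))]_(z in C')
     (cdf_conv F_S k (rest z) - cdf_conv F_S k.+1 (rest z)))%E.
transitivity (\sum_(e : {set 'I_n}) K #|e|)%E.
  by apply: eq_bigr => e _; exact: (P_G e).2.
rewrite (sum_subsets n K) big_mkord; apply: eq_bigr => k _.
by rewrite -[LHS]/(enatmul (K k) 'C(n, k)) -mule_natl muleA -EFinM mulrA.
Qed.

End off_state.

(** * The five formulas *)

Section densities.
Local Open Scope ereal_scope.
Local Notation mu := (@lebesgue_measure R).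
Local Notation dist Y n := (distribution P (psum Y (iota 0 n))).

Let p1_ge0 : (0 <= p1)%R.
Proof. by rewrite -lee_fin -(xi1 0). Qed.

Let p2_ge0 : (0 <= p2)%R.
Proof.
rewrite p2E subr_ge0 -lee_fin -(xi1 0) probability_le1//.
rewrite -[X in measurable X]setTI.
exact: (measurable_funPT (xi 0%N) measurableT [set 1%R] (measurable_set1 _)).
Qed.

Let gap (F : cumulative R R) n x := cdf_conv F n x - cdf_conv F n.+1 x.

Let gapU_ge0 n x : 0 <= gap F_U n x.
Proof. exact: (cdf_conv_decr U_iid U_law n x U_ge0). Qed.

Let gapS_ge0 n x : 0 <= gap F_S n x.
Proof. exact: (cdf_conv_decr S_iid S_law n x S_ge0). Qed.

Let measurable_gapU n : measurable_fun setT (gap F_U n).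
Proof.
by apply: emeasurable_funB; exact: (measurable_cdf_conv U_iid U_law).
Qed.

Let measurable_gapS n : measurable_fun setT (gap F_S n).
Proof.
by apply: emeasurable_funB; exact: (measurable_cdf_conv S_iid S_law).
Qed.

Let measurable_rest1 (h : R -> \bar R) : measurable_fun setT h ->
  measurable_fun setT (fun z => h (rest z)).
Proof. by move=> mh; exact: (measurableT_comp mh measurable_rest). Qed.

Let iota_pdf (Y : nat -> {RV P >-> R}) (F : cumulativeBounded (0 : R)%R (1 : R)%R)
    (f : R -> R) n A : independent_rvs Y ->
  (forall k, has_cdf_pdf (Y k) F f) -> (0 < n)%N -> measurable A ->
  dist Y n A = \int[mu]_(x in A) pdf_conv f n x.
Proof.
move=> indY lawY n0 mA.
by rewrite (psum_pdf indY lawY) ?iota_uniq ?size_iota.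
Qed.

Let iota_null (Y : nat -> {RV P >-> R}) (F : cumulativeBounded (0 : R)%R (1 : R)%R)
    (f : R -> R) n : independent_rvs Y ->
  (forall k, has_cdf_pdf (Y k) F f) -> (0 < n)%N -> dist Y n [set 0%R] = 0.
Proof.
move=> indY lawY n0.
by rewrite (psum_set0_null indY lawY) ?iota_uniq ?size_iota.
Qed.

Let coef_ge0 n k i j : (0 <= 'C(n, k)%:R * p1 ^+ i * p2 ^+ j)%R.
Proof. by rewrite !mulr_ge0// exprn_ge0. Qed.

Let on_term k m n (c : R) B : (0 < k)%N -> (0 < m)%N -> (0 <= c)%R -> measurable B ->
  c%:E * \int[dist S k \x dist L m]_(z in B) gap F_U n (rest z) =
  \int[mu \x mu]_(z in B) (c%:E * pdf_conv f_S k z.1 * pdf_conv f_L m z.2 *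
                           gap F_U n (rest z)).
Proof.
move=> k0 m0 c0 mB.
have mS : measurable_fun setT (fun z : mR * mR => pdf_conv f_S k z.1).
  apply: (measurableT_comp (measurable_law_pdf_conv S_law k)).
  exact: measurable_fst.
have mL : measurable_fun setT (fun z : mR * mR => pdf_conv f_L m z.2).
  apply: (measurableT_comp (measurable_law_pdf_conv L_law m)).
  exact: measurable_snd.
rewrite (integral_product_density (mu1 := mu) (mu2 := mu)
  (measurable_law_pdf_conv S_law k) (law_pdf_conv_ge0 S_law k)
  (fun A => iota_pdf S_iid S_law k0 (A := A))
  (measurable_law_pdf_conv L_law m) (law_pdf_conv_ge0 L_law m)
  (fun A => iota_pdf L_iid L_law m0 (A := A)) mB
  (measurable_rest1 (measurable_gapU n)) (fun z => gapU_ge0 n (rest z))).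
rewrite -ge0_integralZl_EFin//; last 2 first.
- by move=> z _; rewrite !mule_ge0 ?(law_pdf_conv_ge0 S_law) ?(law_pdf_conv_ge0 L_law).
- apply: measurable_funTS; apply: emeasurable_funM => //.
  by apply: emeasurable_funM => //; exact: measurable_rest1.
apply: eq_integral => z _; rewrite -!muleA; congr (_ * _).
by rewrite muleC -muleA.
Qed.

(** Here [k = 0] is allowed: the first coordinate takes its density from the sum of [U], which is
    never empty. *)
Let off_term k m n (c : R) B : (0 < m)%N -> (0 <= c)%R -> measurable B ->
  c%:E * \int[dist U n.+1 \x dist L m]_(z in [set z | B (rest z, z.2)])
    gap F_S k (rest z) =
  \int[mu \x mu]_(z in B) (c%:E * pdf_conv f_U n.+1 (rest z) *
     pdf_conv f_L m z.2 * gap F_S k z.1).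
Proof.
move=> m0 c0 mB.
have mU := measurable_law_pdf_conv U_law n.+1.
have mL : measurable_fun setT (fun z : mR * mR => pdf_conv f_L m z.2).
  apply: (measurableT_comp (measurable_law_pdf_conv L_law m)).
  exact: measurable_snd.
rewrite (integral_product_density (mu1 := mu) (mu2 := mu)
  (measurable_law_pdf_conv U_law n.+1) (law_pdf_conv_ge0 U_law n.+1)
  (fun A => iota_pdf U_iid U_law (ltn0Sn n) (A := A))
  (measurable_law_pdf_conv L_law m) (law_pdf_conv_ge0 L_law m)
  (fun A => iota_pdf L_iid L_law m0 (A := A)) (measurable_off_set mB)
  (measurable_rest1 (measurable_gapS k)) (fun z => gapS_ge0 k (rest z))).
(* The integrand in the coordinates of the occupation times; reflecting it gives the one in the sums
   of [U] and [L], since [rest] undoes itself in the first coordinate. *)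
pose H z := pdf_conv f_U n.+1 (rest z) * pdf_conv f_L m z.2 * gap F_S k z.1 *
  (\1_B z)%:E.
have H0 z : 0 <= H z.
  by rewrite !mule_ge0 ?lee_fin ?(law_pdf_conv_ge0 U_law) ?(law_pdf_conv_ge0 L_law).
have mgap : measurable_fun setT (fun z : mR * mR => gap F_S k z.1).
  by apply: (measurableT_comp (measurable_gapS k)); exact: measurable_fst.
have mH : measurable_fun setT H.
  apply: emeasurable_funM; last exact/measurable_EFinP.
  apply: emeasurable_funM => //; apply: emeasurable_funM => //.
  exact: measurable_rest1.
transitivity (c%:E * \int[mu \x mu]_z H z); last first.
  rewrite -ge0_integralZl_EFin// [RHS]integral_mkcond epatch_indic.
  by apply: eq_integral => z _; rewrite /H !muleA.
congr (_ * _); rewrite -(ge0_integral_plane_reflection t mH H0).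
rewrite integral_mkcond epatch_indic; apply: eq_integral => z _.
rewrite /H /=.
have -> : rest (rest z, z.2) = z.1 by rewrite /rest/=; ring.
rewrite -/(rest z) -[\1_[set _ | _] z]/(\1_B (rest z, z.2)); congr (_ * _).
by rewrite -muleA muleC.
Qed.

Let big_nat_trim (F : nat -> \bar R) n : F 0%N = 0 -> F n = 0 ->
  \sum_(0 <= k < n.+1) F k = \sum_(1 <= k < n) F k.
Proof.
case: n => [|n] F0 Fn; first by rewrite big_nat1 F0 big_geq.
by rewrite big_nat_recr//= Fn adde0 big_ltn// F0 add0e.
Qed.

Let Delta := [set z : R * R | [/\ 0 < z.1, 0 < z.2 & z.1 + z.2 < t]%R].

Let measurable_Delta : measurable (Delta : set (mR * mR)).
Proof.
have m1 : measurable_fun setT (fun z : mR * mR => z.1 : R) by exact: measurable_fst.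
have m2 : measurable_fun setT (fun z : mR * mR => z.2 : R) by exact: measurable_snd.
have mlt (a b : mR * mR -> R) : measurable_fun setT a -> measurable_fun setT b ->
    measurable [set z | (a z < b z)%R].
  move=> ma mb.
  have := measurable_fun_ltr ma mb => /(_ measurableT [set true] I).
  by rewrite setTI.
rewrite (_ : Delta = [set z : mR * mR | (0 < (z.1 : R))%R] `&`
  [set z : mR * mR | (0 < (z.2 : R))%R] `&`
  [set z : mR * mR | ((z.1 : R) + (z.2 : R) < t)%R]).
  apply: measurableI; [apply: measurableI|]; apply: mlt => //.
  exact: measurable_funD.
by apply/seteqP; split => z /=; [move=> [? ? ?]|move=> [[? ?] ?]].
Qed.

Lemma on_state_density : is_density (mu \x mu) (Delta : set (mR * mR))
  (fun B => P [set w | B (St w, Lt w) /\ X w t = 0%N])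
  (fun z => let u := z.1 in let v := z.2 in
     \sum_(1 <= n <oo) \sum_(1 <= k < n)
       ('C(n, k)%:R * p1 ^+ k * p2 ^+ (n - k))%:E
       * pdf_conv f_S k u * pdf_conv f_L (n - k) v
       * (cdf_conv F_U n (t - u - v) - cdf_conv F_U n.+1 (t - u - v))).
Proof.
pose g n (z : mR * mR) := \sum_(1 <= k < n)
  (('C(n, k)%:R * p1 ^+ k * p2 ^+ (n - k))%:E * pdf_conv f_S k z.1 *
   pdf_conv f_L (n - k) z.2 * gap F_U n (rest z)).
have h0 n k z : 0 <= ('C(n, k)%:R * p1 ^+ k * p2 ^+ (n - k))%:E *
    pdf_conv f_S k z.1 * pdf_conv f_L (n - k) z.2 * gap F_U n (rest z).
  by rewrite !mule_ge0 ?lee_fin ?(law_pdf_conv_ge0 S_law) ?(law_pdf_conv_ge0 L_law).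
have mh n k : measurable_fun setT (fun z : mR * mR =>
    ('C(n, k)%:R * p1 ^+ k * p2 ^+ (n - k))%:E *
    pdf_conv f_S k z.1 * pdf_conv f_L (n - k) z.2 * gap F_U n (rest z)).
  apply: emeasurable_funM; last exact: measurable_rest1.
  apply: emeasurable_funM; first apply: emeasurable_funM => //.
    apply: (measurableT_comp (measurable_law_pdf_conv S_law k)).
    exact: measurable_fst.
  apply: (measurableT_comp (measurable_law_pdf_conv L_law (n - k))).
  exact: measurable_snd.
(* The inner sum is empty at [n = 0], so the series may start there, as in [on_state_law]. *)
rewrite (_ : (fun z => _) = fun z => \sum_(0 <= n <oo) g n z); last first.
  apply/funext => z; rewrite -nneseries_from1//; last by rewrite /g big_geq.
  by move=> n; rewrite /g sume_ge0.
apply: is_density_nneseries => //.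
- by move=> n; apply: measurable_funTS; exact: emeasurable_sum.
- by move=> n z _; rewrite /g sume_ge0.
move=> B mB BD; rewrite (on_state_law mB); apply: eq_eseriesr => n _.
(* [B] avoids both axes, while the sum of [S] is the atom at 0 for [k = 0] and the sum of [L] is for
   [k = n]; these two end terms vanish. *)
have B1 : B `<=` (~` [set 0%R] : set mR) `*` (setT : set mR).
  by move=> z /BD[z1 _ _]; split => //= z0; rewrite z0 ltxx in z1.
have B2 : B `<=` (setT : set mR) `*` (~` [set 0%R] : set mR).
  by move=> z /BD[_ z2 _]; split => //= z0; rewrite z0 ltxx in z2.
have m0 : measurable (~` [set 0%R] : set mR).
  by apply: measurableC; exact: measurable_set1.
have mg := measurable_rest1 (measurable_gapU n).
rewrite big_nat_trim; last 2 first.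
- rewrite (integral_null_rectangle _ _ B1) ?mule0//.
  by left; exact: psum_nil_null.
- rewrite subnn (integral_null_rectangle _ _ B2) ?mule0//.
  by right; exact: psum_nil_null.
rewrite ge0_integral_sum//; last by move=> k; exact: measurable_funTS.
apply: eq_big_nat => k /andP[k0 kn]; apply: on_term => //.
by rewrite subn_gt0.
Qed.

Lemma off_state_density : is_density (mu \x mu) (Delta : set (mR * mR))
  (fun B => P [set w | B (St w, Lt w) /\ X w t = 1%N])
  (fun z => let u := z.1 in let v := z.2 in
     \sum_(0 <= n <oo) \sum_(0 <= k < n)
       ('C(n, k)%:R * p1 ^+ k.+1 * p2 ^+ (n - k))%:E
       * pdf_conv f_U n.+1 (t - u - v) * pdf_conv f_L (n - k) v
       * (cdf_conv F_S k u - cdf_conv F_S k.+1 u)).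
Proof.
pose h n k (z : mR * mR) := ('C(n, k)%:R * p1 ^+ k.+1 * p2 ^+ (n - k))%:E *
    pdf_conv f_U n.+1 (rest z) * pdf_conv f_L (n - k) z.2 * gap F_S k z.1.
have h0 n k z : 0 <= h n k z.
  by rewrite !mule_ge0 ?lee_fin ?(law_pdf_conv_ge0 U_law) ?(law_pdf_conv_ge0 L_law).
have mh n k : measurable_fun setT (h n k).
  apply: emeasurable_funM; last first.
    by apply: (measurableT_comp (measurable_gapS k)); exact: measurable_fst.
  apply: emeasurable_funM; first apply: emeasurable_funM => //.
    exact: measurable_rest1 (measurable_law_pdf_conv U_law n.+1).
  apply: (measurableT_comp (measurable_law_pdf_conv L_law (n - k))).
  exact: measurable_snd.
apply: (is_density_nneseries (g := fun n z => \sum_(0 <= k < n) h n k z)) => //.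
- by move=> n; apply: measurable_funTS; exact: emeasurable_sum.
- by move=> n z _; rewrite sume_ge0.
move=> B mB BD; rewrite (off_state_law mB); apply: eq_eseriesr => n _.
(* Only [k = n], where the sum of [L] is empty, drops out. *)
have B2 : [set z | B (rest z, z.2)] `<=` (setT : set mR) `*` (~` [set 0%R] : set mR).
  by move=> z /BD[_ z2 _]; split => //= z0; rewrite /= z0 ltxx in z2.
have m0 : measurable (~` [set 0%R] : set mR).
  by apply: measurableC; exact: measurable_set1.
rewrite big_nat_recr//= subnn (integral_null_rectangle _ _ B2) ?mule0 ?adde0//.
- rewrite ge0_integral_sum//; last by move=> k; exact: measurable_funTS.
  apply: eq_big_nat => k /andP[k0 kn]; apply: off_term => //.
  by rewrite subn_gt0.
- exact: measurable_off_set.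
- by right; exact: psum_nil_null.
- exact: measurable_rest1 (measurable_gapS n).
Qed.

Let msingle : measurable ([set 0%R] : set mR).
Proof. exact: measurable_set1. Qed.

Let msingleC : measurable (~` [set 0%R] : set mR).
Proof. exact: measurableC. Qed.

Lemma on_state_density0 : is_density mu (`]0%R, t[ : set mR)
  (fun B => P [set w | [/\ St w = 0%R, B (Lt w) & X w t = 0%N]])
  (fun v => \sum_(1 <= n <oo) pdf_conv f_L n v *
     (cdf_conv F_U n (t - v) - cdf_conv F_U n.+1 (t - v)) * (p2 ^+ n)%:E).
Proof.
pose g n (v : mR) := pdf_conv f_L n v * gap F_U n (t - (v : R))%R * (p2 ^+ n)%:E.
have g0 n v : 0 <= g n v.
  by rewrite !mule_ge0 ?lee_fin ?(law_pdf_conv_ge0 L_law)// exprn_ge0.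
have mgap n : measurable_fun setT (fun v : mR => gap F_U n (t - (v : R))%R).
  by apply: (measurableT_comp (measurable_gapU n)); exact: measurable_funB.
have mg n : measurable_fun setT (g n).
  apply: emeasurable_funM => //; apply: emeasurable_funM => //.
  exact: measurable_law_pdf_conv L_law n.
rewrite (_ : (fun v => _) = fun v => \sum_(0 <= n <oo) g n v); last first.
  apply/funext => v; rewrite -nneseries_from1//.
  by rewrite /g mul0e mul0e.
apply: is_density_nneseries => //.
- by move=> n; exact: measurable_funTS.
move=> B mB BD; pose C := ([set 0%R] : set mR) `*` B.
have mC : measurable C by exact: measurableX.
transitivity (P [set w | C (St w, Lt w) /\ X w t = 0%N]).
  by congr (P _); apply/seteqP; split => w /=; [case|case; case].
rewrite (on_state_law mC); apply: eq_eseriesr => n _.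
have mgr := measurable_rest1 (measurable_gapU n).
(* Only [k = 0] survives: a nonempty sum of [S] is almost surely not 0. *)
rewrite big_ltn// big_nat big1 ?adde0; last first.
  move=> k /andP[k0 _]; rewrite (integral_null_rectangle msingle mB) ?mule0//.
  by left; exact: iota_null S_iid S_law k0.
(* For [n = 0] the sum of [L] is the atom at 0, which [B] misses; on the other side the dummy value
   of [pdf_conv] at 0 makes the term 0. *)
rewrite bin0 expr0 subn0 !mul1r; have [->|n0] := posnP n.
  rewrite (integral_null_rectangle msingle msingleC (C := C)) ?mule0//.
  - by rewrite integral0_eq// => v _; rewrite /g mul0e mul0e.
  - move=> z [z1 /BD/=]; rewrite in_itv/= => /andP[z2 _]; split => //= z0.
    by rewrite z0 ltxx in z2.
  - by right; exact: psum_nil_null.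
  - exact: measurable_rest1 (measurable_gapU 0).
pose k (z : mR * mR) := gap F_U n (rest z) * (\1_C z)%:E.
have k0 z : 0 <= k z by rewrite mule_ge0// lee_fin.
have mk : measurable_fun setT k.
  by apply: emeasurable_funM => //; exact/measurable_EFinP.
rewrite [in LHS]integral_mkcond epatch_indic -/k.
rewrite (fubini_tonelli1 (m1 := dist S 0) (m2 := dist L n) k mk k0).
rewrite integral_psum_nil; last 2 first.
- exact: measurable_fun_fubini_tonelli_F.
- by move=> x; apply: integral_ge0 => y _; exact: k0.
rewrite /fubini_F (ge0_integral_density (mu := mu) (nu := dist L n)
  (measurable_law_pdf_conv L_law n)
  (law_pdf_conv_ge0 L_law n) (fun A => iota_pdf L_iid L_law n0 (A := A))); last 2 first.
- by apply: (measurableT_comp mk); exact: measurable_pair1.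
- by move=> y; exact: k0.
rewrite -ge0_integralZl_EFin//; last 3 first.
- by move=> y _; rewrite mule_ge0// (law_pdf_conv_ge0 L_law).
- apply: emeasurable_funM; last exact: measurable_law_pdf_conv L_law n.
  by apply: (measurableT_comp mk); exact: measurable_pair1.
- by rewrite exprn_ge0.
rewrite [RHS]integral_mkcond epatch_indic; apply: eq_integral => v _.
rewrite /k /g /rest/= subr0.
have -> : \1_C (0%R : mR, v) = \1_B v :> R.
  by rewrite !indicE; congr (_%:R); congr nat_of_bool; apply/idP/idP;
    rewrite !inE; [case|split].
rewrite [LHS]muleC -!muleA [RHS]muleCA; congr (_ * _).
by rewrite muleC -muleA.
Qed.

Lemma off_state_density0 : is_density mu (`]0%R, t[ : set mR)
  (fun B => P [set w | [/\ B (St w), Lt w = 0%R & X w t = 1%N]])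
  (fun u => \sum_(0 <= n <oo) (p1 ^+ n.+1)%:E * pdf_conv f_U n.+1 (t - u) *
     (cdf_conv F_S n u - cdf_conv F_S n.+1 u)).
Proof.
pose g n (u : mR) := (p1 ^+ n.+1)%:E * pdf_conv f_U n.+1 (t - (u : R))%R *
  gap F_S n u.
have g0 n v : 0 <= g n v.
  by rewrite !mule_ge0 ?lee_fin ?(law_pdf_conv_ge0 U_law)// exprn_ge0.
have mpU n : measurable_fun setT (fun u : mR => pdf_conv f_U n (t - (u : R))%R).
  apply: (measurableT_comp (measurable_law_pdf_conv U_law n)).
  exact: measurable_funB.
have mg n : measurable_fun setT (g n).
  apply: emeasurable_funM; last exact: measurable_gapS.
  exact: emeasurable_funM.
apply: (is_density_nneseries (g := g)) => //.
- by move=> n; exact: measurable_funTS.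
move=> B mB BD; pose C := B `*` ([set 0%R] : set mR).
have mC : measurable C by exact: measurableX.
transitivity (P [set w | C (St w, Lt w) /\ X w t = 1%N]).
  by congr (P _); apply/seteqP; split => w /=; [case|case; case].
rewrite (off_state_law mC); apply: eq_eseriesr => n _.
have mC' := measurable_off_set mC.
(* Only [k = n] survives: for smaller [k] the sum of [L] is nonempty and has no atom at 0. *)
rewrite big_nat_recr//= big_nat big1 ?add0e; last first.
  move=> k /andP[_ kn].
  rewrite (integral_null_rectangle measurableT msingle) ?mule0//.
  - by move=> z [].
  - by right; apply: iota_null L_iid L_law _; rewrite subn_gt0.
  - exact: measurable_rest1 (measurable_gapS k).
rewrite binn subnn expr0 mul1r mulr1.
set C' := [set z | _] in mC' *.
pose k (z : mR * mR) := gap F_S n (rest z) * (\1_C' z)%:E.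
have k0 z : 0 <= k z by rewrite mule_ge0// lee_fin.
have mk : measurable_fun setT k.
  apply: emeasurable_funM; last exact/measurable_EFinP.
  exact: measurable_rest1 (measurable_gapS n).
have mk0 : measurable_fun setT (fun x : mR => k (x, 0%R)).
  by apply: (measurableT_comp mk); exact: measurable_pair2.
rewrite [in LHS]integral_mkcond epatch_indic -/k.
rewrite (fubini_tonelli2 (m1 := dist U n.+1) (m2 := dist L 0) k mk k0).
rewrite integral_psum_nil; last 2 first.
- exact: measurable_fun_fubini_tonelli_G.
- by move=> x; apply: integral_ge0 => y _; exact: k0.
rewrite /fubini_G (ge0_integral_density (mu := mu) (nu := dist U n.+1)
  (measurable_law_pdf_conv U_law n.+1)
  (law_pdf_conv_ge0 U_law n.+1)
  (fun A => iota_pdf U_iid U_law (ltn0Sn n) (A := A)) mk0); last first.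
  by move=> y; exact: k0.
rewrite -ge0_integralZl_EFin//; last 3 first.
- by move=> y _; rewrite mule_ge0// (law_pdf_conv_ge0 U_law).
- apply: emeasurable_funM => //.
  exact: measurable_law_pdf_conv U_law n.+1.
- by rewrite exprn_ge0.
rewrite [RHS]integral_mkcond epatch_indic.
(* With the sum of [L] equal to 0, the plane reflection reduces to [u -> t - u]. *)
rewrite -[RHS](ge0_integral_reflection t); last 2 first.
- by apply: emeasurable_funM; [exact: mg|exact/measurable_EFinP].
- by move=> u; rewrite mule_ge0// lee_fin.
apply: eq_integral => u _.
have -> : k (u, 0%R) = gap F_S n (t - (u : R))%R * (\1_B (t - (u : R))%R)%:E.
  rewrite /k /rest/= subr0; congr (_ * (_)%:E).
  rewrite !indicE; congr (_%:R); congr nat_of_bool; apply/idP/idP;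
    rewrite !inE /C'/= /C/= /rest/= subr0; [by case|by split].
rewrite /g (_ : t - (t - (u : R)) = u)%R; last by ring.
by rewrite -!muleA; congr (_ * _); rewrite muleA muleC.
Qed.

Lemma on_state_atom : (0 < t)%R ->
  P [set w | [/\ St w = 0%R, Lt w = 0%R & X w t = 0%N]] = 1 - (F_U t)%:E.
Proof.
move=> t0; pose C := ([set 0%R] : set mR) `*` ([set 0%R] : set mR).
have mC : measurable C by exact: measurableX.
transitivity (P [set w | C (St w, Lt w) /\ X w t = 0%N]).
  by congr (P _); apply/seteqP; split => w /=; [case|case; case].
(* For [n > 0] one of the two sums is nonempty: that of [S] if [k > 0], that of [L] if [k = 0]. *)
have nullC n k : (0 < n)%N ->
    \int[dist S k \x dist L (n - k)]_(z in C) gap F_U n (rest z) = 0.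
  move=> n0; rewrite (integral_null_rectangle msingle msingle)//.
    have [->|k0] := posnP k; last by left; exact: iota_null S_iid S_law k0.
    by right; apply: iota_null L_iid L_law _; rewrite subn0.
  exact: measurable_rest1 (measurable_gapU n).
rewrite (on_state_law mC) nneseries_recl//; last first.
  move=> n _; apply: sume_ge0 => k _; rewrite mule_ge0 ?lee_fin//.
  by apply: integral_ge0 => z _; exact: gapU_ge0.
rewrite eseries0 ?adde0; last first.
  by move=> n n0 _; rewrite big1// => k _; rewrite nullC// mule0.
rewrite big_nat1 bin0 !expr0 !mul1r mul1e subnn.
pose k (z : mR * mR) := gap F_U 0 (rest z) * (\1_C z)%:E.
have k0 z : 0 <= k z by rewrite mule_ge0// lee_fin.
have mk : measurable_fun setT k.
  apply: emeasurable_funM; last exact/measurable_EFinP.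
  exact: measurable_rest1 (measurable_gapU 0).
rewrite [in LHS]integral_mkcond epatch_indic -/k.
rewrite (fubini_tonelli1 (m1 := dist S 0) (m2 := dist L 0) k mk k0).
rewrite integral_psum_nil; last 2 first.
- exact: measurable_fun_fubini_tonelli_F.
- by move=> x; apply: integral_ge0 => y _; exact: k0.
rewrite /fubini_F integral_psum_nil; last 2 first.
- by apply: (measurableT_comp mk); exact: measurable_pair1.
- by move=> y; exact: k0.
have -> : k (0%R, 0%R) = gap F_U 0 t.
  rewrite /k indicE mem_set// mule1; congr (gap F_U 0 _).
  by rewrite /rest/= !subr0.
(* [cdf_conv] at 1 is a Stieltjes integral; it is identified with [F_U] through the law of the
   one-term sum. *)
have F1 : cdf_conv F_U 1 t = (F_U t)%:E.
  have [<- _ _] := U_law 0%N.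
  rewrite -(psum_cdf U_iid U_law t (s := [:: 0%N]))// /cdf /distribution /pushforward.
  by congr (P _); apply/seteqP; split => w /=; rewrite in_itv/= /psum big_seq1.
by rewrite /gap F1 /= indicE mem_set//= ltW.
Qed.

End densities.
End occupation_laws.

Theorem theorem2 (R : realType) (d : measure_display) (T : measurableType d)
    (P : probability T R)
    (U S L xi : nat -> {RV P >-> R})
    (F_U F_S F_L : cumulativeBounded (0 : R) (1 : R)) (f_U f_S f_L : R -> R)
    (p1 p2 : R)
    (U_ge0 : forall k w, 0 <= U k w)
    (S_ge0 : forall k w, 0 <= S k w)
    (L_ge0 : forall k w, 0 <= L k w)
    (U_iid : independent_rvs U)
    (S_iid : independent_rvs S)
    (L_iid : independent_rvs L)
    (xi_iid : independent_rvs xi)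
    (indep : independent_seqs4 U S L xi)
    (U_law : forall k, has_cdf_pdf (U k) F_U f_U)
    (S_law : forall k, has_cdf_pdf (S k) F_S f_S)
    (L_law : forall k, has_cdf_pdf (L k) F_L f_L)
    (p1_gt0 : 0 < p1)
    (p2E : p2 = 1 - p1)
    (xi_law : forall k, P [set w | xi k w = 1] = p1%:E
                     /\ P [set w | xi k w = 0] = p2%:E)
    (t : R) (t_gt0 : 0 < t) :
  let X := onoff U S L xi in
  let St := occupation U S L xi 1 t in
  let Lt := occupation U S L xi 2 t in
  let mu := @lebesgue_measure R in
  let Delta := [set z : R * R | [/\ 0 < z.1, 0 < z.2 & z.1 + z.2 < t]] in
  [/\ P [set w | [/\ St w = 0, Lt w = 0 & X w t = 0%N]] = (1 - (F_U t)%:E)%E,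
      is_density mu `]0, t[
        (fun B => P [set w | [/\ St w = 0, B (Lt w) & X w t = 0%N]])
        (fun v => \sum_(1 <= n <oo)
           pdf_conv f_L n v
           * (cdf_conv F_U n (t - v) - cdf_conv F_U n.+1 (t - v))
           * (p2 ^+ n)%:E)%E,
      is_density mu `]0, t[
        (fun B => P [set w | [/\ B (St w), Lt w = 0 & X w t = 1%N]])
        (fun u => \sum_(0 <= n <oo)
           (p1 ^+ n.+1)%:E * pdf_conv f_U n.+1 (t - u)
           * (cdf_conv F_S n u - cdf_conv F_S n.+1 u))%E,
      is_density (mu \x mu)%E Delta
        (fun B => P [set w | B (St w, Lt w) /\ X w t = 0%N])
        (fun z => let u := z.1 in let v := z.2 in
           \sum_(1 <= n <oo) \sum_(1 <= k < n)
             ('C(n, k)%:R * p1 ^+ k * p2 ^+ (n - k))%:E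
             * pdf_conv f_S k u * pdf_conv f_L (n - k) v
             * (cdf_conv F_U n (t - u - v) - cdf_conv F_U n.+1 (t - u - v)))%E
    & is_density (mu \x mu)%E Delta
        (fun B => P [set w | B (St w, Lt w) /\ X w t = 1%N])
        (fun z => let u := z.1 in let v := z.2 in
           \sum_(0 <= n <oo) \sum_(0 <= k < n)
             ('C(n, k)%:R * p1 ^+ k.+1 * p2 ^+ (n - k))%:E
             * pdf_conv f_U n.+1 (t - u - v) * pdf_conv f_L (n - k) v
             * (cdf_conv F_S k u - cdf_conv F_S k.+1 u))%E].
Proof.
have xi1 k := (xi_law k).1.
move=> X St Lt mu Delta; split.
- exact: (on_state_atom U_ge0 S_ge0 L_ge0 U_iid S_iid L_iid xi_iid indep
    U_law S_law L_law p2E xi1).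
- exact: (on_state_density0 U_ge0 S_ge0 L_ge0 U_iid S_iid L_iid xi_iid indep
    U_law S_law L_law p2E xi1).
- exact: (off_state_density0 U_ge0 S_ge0 L_ge0 U_iid S_iid L_iid xi_iid indep
    U_law S_law L_law p2E xi1).
- exact: (on_state_density U_ge0 S_ge0 L_ge0 U_iid S_iid L_iid xi_iid indep
    U_law S_law L_law p2E xi1).
- exact: (off_state_density U_ge0 S_ge0 L_ge0 U_iid S_iid L_iid xi_iid indep
    U_law S_law L_law p2E xi1).
Qed.
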